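(* Let $\rho\in\mathcal P$ be a cumulative bid distribution. Then: (1) There exists $j\in\mathbb N$ such that $T_\rho^j:\mathcal V\to\mathcal V$ is a contraction mapping (in the $w$-norm). Hence there exists a unique $f^*_\rho\in\mathcal V$ such that $T_\rho f^*_\rho=f^*_\rho$, and for any $f\in\mathcal V$, $T_\rho^nf\to f^*_\rho$ as $n\to\infty$. (2) The fixed point $f^*_\rho$ is the unique solution of the optimality (Bellman) equation $$\hat V_\rho(q)=C(q)+\beta\,\mathbb E_A[\hat V_\rho(q+A)]+\inf_{x\in\mathbb R^+}\Big[r_\rho(x)-p_\rho(x)\,\beta\,\mathbb E_A\big(\hat V_\rho(q+A)-\hat V_\rho((q-1)^++A)\big)\Big],\quad q\in\mathbb R^+,$$ i.e. $f^*_\rho=\hat V_\rho$. (3) Let $\hat\theta_\rho(q)=\beta\,(\Delta\hat V_\rho(q))^+$, where $\Delta f(q)=\mathbb E_A(f(q+A)-f((q-1)^++A))$. Then $\hat\theta_\rho$ is an optimal policy.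
   Context: Notation: $\mathbb R^+=[0,\infty)$, $z^+=\max(z,0)$. Fix an integer $M\ge 2$ and $\beta\in(0,1)$. Let $\Phi$ be a probability distribution (of job arrivals) on $[0,\bar A]$, $\bar A<\infty$, with a bounded density; $\mathbb E_A$ is expectation over $A\sim\Phi$. The holding cost $C:\mathbb R^+\to\mathbb R^+$ is continuous, increasing, strictly convex, and $C(q)=O(q^m)$ for some integer $m$. $\mathcal P=\{G: G \text{ is a continuous c.d.f. of a probability measure on }\mathbb R^+,\ \int_0^\infty(1-G(x))\,dx<E\}$ for a fixed finite $E$. For $\rho\in\mathcal P$: $p_\rho(x)=\rho(x)^{M-1}$ and $r_\rho(x)=xp_\rho(x)-\int_0^xp_\rho(u)\,du$. Decision problem: $\hat V_\rho(q)=\inf_\theta\mathbb E\big[\sum_{t\ge0}\beta^t(C(Q_t)+r_\rho(\theta(Q_t)))\mid Q_0=q\big]$, the infimum over measurable $\theta:\mathbb R^+\to\mathbb R^+$ (Markov deterministic policies), where, given $Q_t$, $Q_{t+1}=(Q_t-1)^++A_t$ with probability $p_\rho(\theta(Q_t))$ and $Q_{t+1}=Q_t+A_t$ otherwise, $A_t$ i.i.d. $\sim\Phi$. A policy is optimal if it attains the infimum for every $q$. $w(q)=\max\{C(q),1\}$; $\|f\|_w=\sup_{q\in\mathbb R^+}|f(q)/w(q)|$; $\mathcal V$ is the set of (measurable) $f:\mathbb R^+\to\mathbb R^+$ with $\|f\|_w<\infty$. The operator $T_\rho$ is $$(T_\rho f)(q)=C(q)+\beta\,\mathbb E_Af(q+A)+\inf_{x\in\mathbb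 R^+}\Big[r_\rho(x)-p_\rho(x)\beta\,\mathbb E_A\big(f(q+A)-f((q-1)^++A)\big)\Big].$$
   Formalization: The holding cost is additionally assumed to satisfy C(2q)=O(C(q)) as q→∞; with C(q)=O(q^m) alone, C(q+a)/C(q) can be unbounded and T_ρ need not map V into V, so claim (1) fails. *)

(* Defs.v *)
From mathcomp Require Export all_boot all_order all_algebra.
From mathcomp Require Export all_classical all_reals all_analysis.

Set Implicit Arguments.
Unset Strict Implicit.
Unset Printing Implicit Defensive.

Export Order.TTheory GRing.Theory Num.Theory numFieldNormedType.Exports.

Global Open Scope classical_set_scope.
Global Open Scope ring_scope.

(* Functions on R^+ are represented by functions R -> R of which only the values
   on [Rplus] matter: regularity is required on [Rplus] only, and equality of
   functions is equality on [Rplus]. *)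
Definition Rplus {R : realType} : set R := `[0, +oo[%classic.

Definition pos {R : realType} (z : R) : R := Num.max z 0.

(** * Primitive data *)

Definition strictly_convex_on {R : realType} (D : set R) (f : R -> R) : Prop :=
  forall x y t : R, D x -> D y -> x != y -> 0 < t -> t < 1 ->
    f (t * x + (1 - t) * y) < t * f x + (1 - t) * f y.

(* f(q) = O(g(q)) as q -> +oo: what [f =O_F g] unfolds to; the library has no
   canonical [filter_on] instance for the filter +oo. *)
Definition bigO_infty {R : realType} (f g : R -> R) : Prop :=
  exists2 k : R, 0 < k & \forall q \near +oo, `|f q| <= k * `|g q|.

Definition arrival_law {R : realType} (Abar : R) (Phi : probability R R) : Prop :=
  Phi `[0, Abar]%classic = 1%E /\
  exists (phi : R -> R) (K : R),
    [/\ measurable_fun setT phi,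
        forall x, 0 <= phi x <= K &
        forall B : set R, measurable B ->
          Phi B = (\int[lebesgue_measure]_(x in B) (phi x)%:E)%E].

Definition bid_distribution {R : realType} (E : R) (G : R -> R) : Prop :=
  [/\ exists mu : probability R R,
        mu Rplus = 1%E /\ forall x : R, (G x)%:E = mu `]-oo, x]%classic,
      continuous G &
      (\int[lebesgue_measure]_(x in Rplus) (1 - G x)%:E < E%:E)%E].

Definition win_prob {R : realType} (M : nat) (rho : R -> R) (x : R) : R :=
  rho x ^+ M.-1.

Definition payment {R : realType} (M : nat) (rho : R -> R) (x : R) : R :=
  x * win_prob M rho x
  - \int[lebesgue_measure]_(u in `[0, x]) win_prob M rho u.

(** * Weighted sup-norm space and Bellman operator *)

Definition weight {R : realType} (C : R -> R) (q : R) : R := Num.max (C q) 1.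

Definition wnorm {R : realType} (C f : R -> R) : \bar R :=
  ereal_sup [set (`|f q / weight C q|)%:E | q in Rplus].

Definition wspace {R : realType} (C : R -> R) : set (R -> R) :=
  [set f : R -> R | [/\ measurable_fun Rplus f,
               forall q, Rplus q -> 0 <= f q &
               (wnorm C f < +oo)%E]].

Definition wcontraction {R : realType} (C : R -> R)
    (S : (R -> R) -> (R -> R)) : Prop :=
  (forall f, wspace C f -> wspace C (S f)) /\
  exists k : R, [/\ 0 <= k, k < 1 &
    forall f g, wspace C f -> wspace C g ->
      (wnorm C (S f \- S g)%R <= k%:E * wnorm C (f \- g)%R)%E].

(* Phi is concentrated on [Rplus], so this is the expectation of g(A), A ~ Phi,
   for a g which is meaningful on R^+ only. *)
Definition EA {R : realType} (Phi : probability R R) (g : R -> R) : R :=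
  \int[Phi]_(a in Rplus) g a.

Definition Delta {R : realType} (Phi : probability R R) (f : R -> R) (q : R) : R :=
  EA Phi (fun a => f (q + a) - f (pos (q - 1) + a)).

Definition bellman {R : realType} (M : nat) (beta : R) (Phi : probability R R)
    (C rho : R -> R) (f : R -> R) (q : R) : R :=
  C q + beta * EA Phi (fun a => f (q + a))
  + inf [set payment M rho x - win_prob M rho x * (beta * Delta Phi f q)
        | x in Rplus].

(** * The decision problem *)

(* A probability space carrying i.i.d. arrivals A_t ~ Phi together with i.i.d.
   uniform variables U_t, all of them mutually independent; the auction of slot t
   is won iff U_t <= p, an event of probability p.  Taking some of the F t, G t
   equal to setT in the last clause yields all the finite subfamilies. *)
Definition driving_noise {R : realType} (d : measure_display)
    (Omega : measurableType d) (P : probability Omega R) (Phi : probability R R)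
    (A U : nat -> {RV P >-> R}) : Prop :=
  [/\ forall t x, 0 <= A t x,
      forall t (B : set R), measurable B -> distribution P (A t) B = Phi B,
      forall t (B : set R), measurable B ->
        distribution P (U t) B = uniform_prob (@ltr01 R) B &
      forall (n : nat) (F G : nat -> set R),
        (forall t, measurable (F t)) -> (forall t, measurable (G t)) ->
        P (\bigcap_(t < n) (A t @^-1` F t `&` U t @^-1` G t)) =
        (\prod_(t < n) (P (A t @^-1` F t) * P (U t @^-1` G t)))%E].

Definition policy {R : realType} : set (R -> R) :=
  [set theta : R -> R | measurable_fun Rplus theta /\
               forall q, Rplus q -> 0 <= theta q].

Fixpoint queue {R : realType} {Omega : Type} (p theta : R -> R)
    (A U : nat -> Omega -> R) (q : R) (t : nat) (x : Omega) : R :=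
  if t is s.+1 then
    let Qs := queue p theta A U q s x in
    (if U s x <= p (theta Qs) then pos (Qs - 1) else Qs) + A s x
  else q.

Definition policy_cost {R : realType} (d : measure_display)
    (Omega : measurableType d) (P : probability Omega R)
    (A U : nat -> {RV P >-> R}) (M : nat) (beta : R) (C rho theta : R -> R)
    (q : R) : \bar R :=
  (\int[P]_x \sum_(0 <= t <oo)
     (let Qt := queue (win_prob M rho) theta A U q t x in
      beta ^+ t * (C Qt + payment M rho (theta Qt)))%:E)%E.

Definition value {R : realType} (d : measure_display)
    (Omega : measurableType d) (P : probability Omega R)
    (A U : nat -> {RV P >-> R}) (M : nat) (beta : R) (C rho : R -> R)
    (q : R) : \bar R :=
  ereal_inf [set policy_cost A U M beta C rho theta q | theta in policy].

Definition optimal_policy {R : realType} (d : measure_display)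
    (Omega : measurableType d) (P : probability Omega R)
    (A U : nat -> {RV P >-> R}) (M : nat) (beta : R) (C rho : R -> R)
    (theta : R -> R) : Prop :=
  policy theta /\
  forall q, Rplus q ->
    policy_cost A U M beta C rho theta q = value A U M beta C rho q.

(* Main.v *)
(* Convexity and doubling give C (q + Abar) <= (1 + eps) C q for large q, hence
   a weight W, equivalent to weight C, with W (q + Abar) <= gamma W q and
   beta gamma < 1. As p is nondecreasing, the infimum in the Bellman operator T
   is attained at the bid beta (Delta f q)^+, so T is the minimum over x of
   one-step lookaheads and contracts the W-norm by the factor beta gamma; Banach's
   argument gives the fixed point f. Along any policy f (Q_t) is at most the
   expected stage cost plus beta E f (Q_{t+1}), with equality for the minimising
   bid; iterating, beta^n E f (Q_n) <= K (beta gamma)^n W q vanishes, and f is the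
   value. *)
Require Import Defs.
From mathcomp Require Import measurable_realfun ring lra zify.

Set Implicit Arguments.
Unset Strict Implicit.
Unset Printing Implicit Defensive.

(** The auxiliary weight is forced: near the origin the mean of C (q + A) may exceed weight C q /
    beta, so T itself may fail to contract the norm of [weight C]. Returning from W to [weight C]
    costs a constant factor D, which only a power of T can beat; this is the origin of the exponent
    j. The probabilistic obstacle is the one-step formula for E f (Q_{t+1}). The noise is only known
    to satisfy a product formula on finite families of events, so Q_t is shown independent of all
    noise not yet used, one variable at a time, by uniqueness of finite measures that agree on
    rectangles. Value functions and policies are regular on [Rplus] only; they are extended by zero
    wherever measurability on the whole line is required. Costs are nonnegative and are integrated
    in the extended reals, so policies of infinite cost are covered by the same argument. *)

Section bids.
Context {R : realType} (M : nat) (E : R) (rho : R -> R).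
Hypotheses (M_ge2 : (2 <= M)%N) (rhoP : bid_distribution E rho).
Local Notation p := (win_prob M rho).
Local Notation r := (payment M rho).

(** * Bid distribution, winning probability and payment *)

Lemma bid_ge0 x : 0 <= rho x.
Proof. by case: rhoP => -[mu [_ h]] _ _; rewrite -lee_fin h. Qed.

Lemma bid_le1 x : rho x <= 1.
Proof. by case: rhoP => -[mu [_ h]] _ _; rewrite -lee_fin h probability_le1. Qed.

Lemma bid_ndecr : {homo rho : x y / x <= y}.
Proof.
case: rhoP => -[mu [_ h]] _ _ x y xy; rewrite -lee_fin !h.
by apply: le_measure; rewrite ?inE//; apply: subitvPr; rewrite bnd_simp.
Qed.

Lemma bid_lt0 x : x < 0 -> rho x = 0.
Proof.
case: rhoP => -[mu [mu1 h]] _ _ x0; apply/eqP; rewrite -eqe h.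
rewrite eq_le measure_ge0 andbT.
have muN : mu (~` Rplus) = 0%E.
  by rewrite probability_setC ?mu1 ?subee//; exact: measurable_itv.
rewrite -[leRHS]muN.
apply: le_measure; rewrite ?inE//; first by apply: measurableC; exact: measurable_itv.
move=> y /=; rewrite /Rplus/= !in_itv/= andbT => yx; apply/negP; rewrite -ltNge.
exact: le_lt_trans yx x0.
Qed.

(** A continuous c.d.f. has no atom at 0: its value there is the left limit of zeros. *)
Lemma bid0 : rho 0 = 0.
Proof.
have cont0 : rho z @[z --> 0^'-] --> rho 0.
  by apply: cvg_at_left_filter; case: rhoP => _ + _; exact.
rewrite -(cvg_lim _ cont0)//; apply: lim_near_cst => //.
by near=> z; apply: bid_lt0; near: z; exact: nbhs_left_lt.
Unshelve. all: by end_near. Qed.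

Lemma win_prob_ge0 x : 0 <= p x.
Proof. by rewrite exprn_ge0// bid_ge0. Qed.

Lemma win_prob_le1 x : p x <= 1.
Proof. by rewrite exprn_ile1 ?bid_ge0 ?bid_le1. Qed.

Lemma win_prob_ndecr : {homo p : x y / x <= y}.
Proof. by move=> x y /bid_ndecr xy; rewrite lerXn2r// nnegrE bid_ge0. Qed.

Lemma win_prob0 : p 0 = 0.
Proof. by rewrite /win_prob bid0 expr0n; case: M M_ge2 => [|[|]]. Qed.

Lemma measurable_win_prob : measurable_fun setT p.
Proof. by apply: nondecreasing_measurable => //; exact: win_prob_ndecr. Qed.

Let I x := \int[lebesgue_measure]_(u in `[0, x]) p u.

Lemma win_prob_integrable (a b : itv_bound R) : (a != -oo)%O -> (b != +oo)%O ->
  lebesgue_measure.-integrable [set` Interval a b] (EFin \o p).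
Proof.
move=> a_fin b_fin; apply: measurable_bounded_integrable => //=.
- rewrite lebesgue_measure_itv/=; case: ifP => //.
  by case: a a_fin => [? ?|[]]//; case: b b_fin => [? ?|[]]//= _ _ _; exact: ltey.
- apply: measurable_funS measurable_win_prob => //.
- exists 1; split => // z z1 x _ /=; rewrite ger0_norm ?win_prob_ge0//.
  exact: le_trans (win_prob_le1 x) (ltW z1).
Qed.

(** Rectangle bounds for a monotone integrand. They compare the payments of two bids directly, and
    give its sign and its minimiser. *)
Lemma int_win_prob_bounds x y : 0 <= x -> x <= y ->
  (y - x) * p x <= I y - I x <= (y - x) * p y.
Proof.
move=> x0 xy; rewrite /I Rintegral_itvB ?bnd_simp//; last exact: win_prob_integrable.
have len : fine (lebesgue_measure `]x, y]%classic) = y - x.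
  rewrite lebesgue_measure_itv/= lte_fin; case: ltP => [//|yx].
  by rewrite (le_anti (introT andP (conj xy yx))) subrr.
have ecst c : (y - x) * c = \int[lebesgue_measure]_(u in `]x, y]) c.
  by rewrite Rintegral_cst//= len mulrC.
have icst c : lebesgue_measure.-integrable `]x, y] (EFin \o cst c : R -> \bar R).
  apply: measurable_bounded_integrable => //=.
    by rewrite lebesgue_measure_itv/=; case: ifP => // _; exact: ltey.
  by exists `|c|; split => // z cz u _ /=; exact: ltW.
have ip := @win_prob_integrable (BRight x) (BRight y) isT isT.
rewrite !ecst; apply/andP; split.
- apply: le_Rintegral => //; first exact: icst.
  by move=> u /=; rewrite in_itv/= => /andP[/ltW xu _]; exact: win_prob_ndecr.
- apply: le_Rintegral => //; first exact: icst.
  by move=> u /=; rewrite in_itv/= => /andP[_ uy]; exact: win_prob_ndecr.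
Qed.

Lemma int_win_prob0 : I 0 = 0.
Proof. by rewrite /I set_itv1 Rintegral_set1. Qed.

Lemma payment0 : r 0 = 0.
Proof. by rewrite /payment mul0r -/(I 0) int_win_prob0 subrr. Qed.

Lemma payment_ge0 x : 0 <= x -> 0 <= r x.
Proof.
move=> x0; have /andP[_] := int_win_prob_bounds (lexx 0) x0.
by rewrite int_win_prob0 !subr0 subr_ge0.
Qed.

(** The subtracted integral is nondecreasing on the whole line, being 0 over the empty interval when
    x < 0. *)
Lemma measurable_payment : measurable_fun setT r.
Proof.
apply: measurable_funB; first exact: measurable_funM measurable_win_prob.
apply: nondecreasing_measurable => // x y xy; rewrite -!/(I _).
have I0 z : z < 0 -> I z = 0 by move=> z0; rewrite /I set_itv_ge ?Rintegral_set0// bnd_simp -ltNge.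
have Ige0 z : 0 <= I z by apply: Rintegral_ge0 => u _; exact: win_prob_ge0.
have [/I0 ->//|x0] := ltP x 0.
have /andP[h _] := int_win_prob_bounds x0 xy.
by rewrite -subr_ge0 (le_trans _ h)// mulr_ge0 ?subr_ge0 ?win_prob_ge0.
Qed.

(* Since r dx = x dp, the marginal payoff of raising the bid x is (x - b) dp. *)
Lemma payment_argmin b x : 0 <= x ->
  r (pos b) - p (pos b) * b <= r x - p x * b.
Proof.
move=> x0; rewrite /pos; have [b0|b0] := leP b 0; last first.
  rewrite /payment -!/(I _).
  have [xb|bx] := leP x b.
    have /andP[h _] := int_win_prob_bounds x0 xb; lra.
  have /andP[_ h] := int_win_prob_bounds (ltW b0) (ltW bx); lra.
rewrite payment0 win_prob0 mul0r subrr -mulrN addr_ge0 ?payment_ge0//.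
by rewrite mulr_ge0 ?win_prob_ge0// oppr_ge0.
Qed.

(** Replaces the infimum of the Bellman operator by a closed formula, from which measurability in
    the state can be read off. *)
Lemma inf_payment b :
  inf [set r x - p x * b | x in Rplus] = r (pos b) - p (pos b) * b.
Proof.
have pb : Rplus (pos b) by rewrite /Rplus/= in_itv/= andbT /pos le_max lexx orbT.
apply/le_anti/andP; split.
  apply: ge_inf; last by exists (pos b).
  exists (r (pos b) - p (pos b) * b) => _ [x + <-].
  by rewrite /Rplus/= in_itv/= andbT; exact: payment_argmin.
apply: lb_le_inf; first by exists (r (pos b) - p (pos b) * b), (pos b).
move=> _ [x + <-]; rewrite /Rplus/= in_itv/= andbT; exact: payment_argmin.
Qed.

End bids.

Lemma RplusE (R : realType) (q : R) : Rplus q = (0 <= q) :> Prop.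
Proof. by rewrite /Rplus/= in_itv/= andbT. Qed.

Lemma measurable_Rplus (R : realType) : measurable (Rplus : set R).
Proof. exact: measurable_itv. Qed.

Lemma pos_ge0 (R : realType) (z : R) : 0 <= pos z.
Proof. by rewrite /pos le_max lexx orbT. Qed.

Lemma pos_subr1_le (R : realType) (q : R) : 0 <= q -> pos (q - 1) <= q.
Proof. by move=> q0; rewrite /pos ge_max q0 andbT; lra. Qed.

(** * Growth of the cost, equivalent weight and weighted norm *)

Section weight.
Context {R : realType} (C : R -> R).
Hypotheses (C_ge0 : forall q, Rplus q -> 0 <= C q)
  (C_cont : {within Rplus, continuous C})
  (C_incr : forall x y, Rplus x -> Rplus y -> x <= y -> C x <= C y)
  (C_conv : strictly_convex_on Rplus C)
  (C_doubling : bigO_infty (fun q => C (2 * q)) C).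

(* By convexity, C (q + a) <= (1 - a / q) C q + (a / q) C (2 q). *)
Lemma cost_slow_growth (a g : R) : 0 <= a -> 1 < g ->
  exists2 Q, 0 <= Q & forall q, Q <= q -> C (q + a) <= g * C q.
Proof.
move=> a0 g1; case: C_doubling => k k0 [Q1 [_ HQ]].
(* For q >= Q: the first two terms put q in the range of the doubling bound, the third gives a < q,
   and the last gives (a / q) * k <= g - 1. *)
pose Q := `|Q1| + 1 + a + k * a / (g - 1).
have g0 : 0 < g - 1 by rewrite subr_gt0.
have kag : 0 <= k * a / (g - 1) by rewrite divr_ge0 ?mulr_ge0 // ltW.
have Q0 : 0 <= Q by rewrite /Q; have := normr_ge0 Q1; lra.
exists Q => // q Qq.
have q0 : 0 <= q by exact: le_trans Qq.
have Cq0 : 0 <= C q by apply: C_ge0; rewrite RplusE.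
move: a0; rewrite le_eqVlt => /predU1P[<-|a0]; first by rewrite addr0 ler_peMl// ltW.
have aq : a < q by apply: lt_le_trans Qq; rewrite /Q; have := normr_ge0 Q1; lra.
have qgt0 : 0 < q by exact: lt_trans aq.
have C2 : C (2 * q) <= k * C q.
  have /HQ : Q1 < q by apply: lt_le_trans Qq; rewrite /Q; have := ler_norm Q1; lra.
  by rewrite !ger0_norm//; apply: C_ge0; rewrite RplusE mulr_ge0.
pose t := a / q.
have t0 : 0 < t by rewrite divr_gt0.
have t1 : t < 1 by rewrite ltr_pdivrMr// mul1r.
have tk : t * k <= g - 1.
  rewrite /t mulrAC ler_pdivrMr// mulrC [leRHS]mulrC -ler_pdivrMr//.
  by apply: le_trans Qq; rewrite /Q; have := normr_ge0 Q1; lra.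
have qa : q + a = t * (2 * q) + (1 - t) * q by rewrite /t; field; rewrite gt_eqF.
have q2 : 2 * q != q by rewrite gt_eqF//; lra.
have /ltW : C (q + a) < t * C (2 * q) + (1 - t) * C q.
  by rewrite qa; apply: C_conv; rewrite // RplusE// mulr_ge0.
move=> /le_trans; apply.
have := ler_wpM2l (ltW t0) C2; have := ler_wpM2r Cq0 tk; have := mulr_ge0 (ltW t0) Cq0; lra.
Qed.

Lemma measurable_cost : measurable_fun Rplus C.
Proof. by apply: subspace_continuous_measurable_fun => //; exact: measurable_Rplus. Qed.

Lemma weight_ge1 q : 1 <= weight C q.
Proof. by rewrite /weight le_max lexx orbT. Qed.

Lemma weight_gt0 q : 0 < weight C q.
Proof. exact: lt_le_trans ltr01 (weight_ge1 q). Qed.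

(* W = max (weight C) (weight C (Q + a)): the constant absorbs the growth below Q. *)
Lemma weight_equiv (a g : R) : 0 <= a -> 1 < g ->
  exists W D, [/\ measurable_fun Rplus W, 1 <= D,
    forall q, 0 <= q -> weight C q <= W q <= D * weight C q,
    forall x y, 0 <= x -> x <= y -> W x <= W y &
    forall q, 0 <= q -> W (q + a) <= g * W q].
Proof.
move=> a0 g1; have [Q Q0 HQ] := cost_slow_growth a0 g1.
pose D := weight C (Q + a); exists (fun q => Num.max (weight C q) D), D.
have D1 : 1 <= D by exact: weight_ge1.
have D0 : 0 < D by exact: weight_gt0.
have Wmon x y : 0 <= x -> x <= y -> weight C x <= weight C y.
  move=> x0 xy; rewrite /weight ge_max le_max C_incr ?RplusE//; last exact: le_trans xy.
  by rewrite le_max lexx orbT.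
have mW : measurable_fun Rplus (weight C).
  by apply: measurable_maxr; [exact: measurable_cost|exact: measurable_cst].
split => //.
- by apply: measurable_maxr => //; exact: measurable_cst.
- move=> q q0; rewrite le_max lexx/= ge_max.
  by rewrite ler_peMl ?ler_peMr ?weight_ge1 ?(ltW D0) ?(ltW (weight_gt0 _)).
- move=> x y x0 xy; rewrite ge_max; apply/andP; split.
    by rewrite le_max (Wmon _ _ x0 xy).
  by rewrite le_max lexx orbT.
- move=> q q0; have gD : D <= g * Num.max (weight C q) D.
    by rewrite -[D in leLHS]mul1r ler_pM ?(ltW g1) ?(ltW D0)// le_max lexx orbT.
  have [Qq|qQ] := leP Q q; last first.
    by apply: le_trans gD; rewrite ge_max lexx andbT Wmon ?addr_ge0// lerD2r ltW.
  rewrite ge_max gD andbT /weight ge_max; apply/andP; split.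
    apply: (le_trans (HQ _ Qq)); rewrite ler_pM2l ?(lt_trans _ g1)//.
    by rewrite -maxA le_max lexx.
  by rewrite -[leLHS]mulr1 ler_pM ?(ltW g1)// !le_max lexx orbT.
Qed.

Lemma wnorm_leP (f : R -> R) (K : R) :
  (wnorm C f <= K%:E)%E <-> forall q, 0 <= q -> `|f q| <= K * weight C q.
Proof.
have e q : `|f q / weight C q| = `|f q| / weight C q.
  by rewrite normrM normfV (gtr0_norm (weight_gt0 q)).
split=> [h q q0|h].
  rewrite -ler_pdivrMr ?weight_gt0// -e -lee_fin; apply: le_trans h.
  by apply: ereal_sup_ubound; exists q => //; rewrite RplusE.
apply: ge_ereal_sup => _ [q + <-]; rewrite RplusE => q0.
by rewrite lee_fin e ler_pdivrMr ?weight_gt0// h.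
Qed.

Lemma wnorm_ge0 (f : R -> R) : (0 <= wnorm C f)%E.
Proof.
apply: (@le_trans _ _ (`|f 0 / weight C 0|)%:E); first by rewrite lee_fin.
by apply: ereal_sup_ubound; exists 0 => //; rewrite RplusE.
Qed.

Lemma wnorm_fin (f : R -> R) : (wnorm C f < +oo)%E ->
  exists2 K, 0 <= K & wnorm C f = K%:E.
Proof.
have := wnorm_ge0 f; case: (wnorm C f) => // r; rewrite lee_fin => r0 _.
by exists r.
Qed.

(** Serves to pass from the fixed point to the value function, which is known to equal it on [Rplus]
    only. *)
Lemma eq_wspace (f g : R -> R) : (forall q, 0 <= q -> f q = g q) ->
  wspace C f -> wspace C g.
Proof.
move=> fg [mf f0 nf]; split.
- by apply: eq_measurable_fun mf => q; rewrite inE RplusE => /fg.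
- by move=> q q0; rewrite -fg ?f0// -RplusE.
- have [K _ fK] := wnorm_fin nf; apply: le_lt_trans (ltry K).
  apply/wnorm_leP => q q0; rewrite -fg//; apply: (wnorm_leP f K).1 q0.
  by rewrite fK.
Qed.

End weight.

(** * Expectation over the arrivals *)

Section arrivals.
Context {R : realType} (Abar : R) (Phi : probability R R).
Hypothesis PhiP : arrival_law Abar Phi.

Lemma arrival_bound_ge0 : 0 <= Abar.
Proof.
rewrite leNgt; apply/negP => A0; case: PhiP => + _.
by rewrite set_itv_ge ?measure0 ?bnd_simp -?ltNge// => /eqP; rewrite eqe eq_sym oner_eq0.
Qed.

Lemma arrival_gt_bound : Phi (~` `[0, Abar]) = 0%E.
Proof. by case: PhiP => Phi1 _; rewrite probability_setC// Phi1 subee. Qed.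

Lemma arrival_Rplus : Phi Rplus = 1%E.
Proof.
apply/eqP; rewrite eq_le probability_le1/=; last exact: measurable_Rplus.
case: PhiP => <- _; apply: le_measure; rewrite ?inE//; first exact: measurable_Rplus.
by move=> a /=; rewrite RplusE in_itv/= => /andP[].
Qed.

Lemma arrival_lt0 : Phi (~` Rplus) = 0%E.
Proof. by rewrite probability_setC ?arrival_Rplus ?subee//; exact: measurable_Rplus. Qed.

Lemma RplusD : Rplus `\` (Rplus `\` `[0, Abar]) = `[0, Abar]%classic :> set R.
Proof.
rewrite setDD; apply: setIidr => a /=; rewrite RplusE in_itv/= => /andP[] //.
Qed.

Lemma measurable_RplusD : measurable (Rplus `\` `[0, Abar] : set R).
Proof. by apply: measurableD => //; exact: measurable_Rplus. Qed.

Lemma arrival_RplusD : Phi (Rplus `\` `[0, Abar]) = 0%E.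
Proof.
apply/eqP; rewrite eq_le measure_ge0 andbT -[leRHS]arrival_gt_bound.
apply: le_measure; rewrite ?inE; last by move=> a [].
- exact: measurable_RplusD.
- exact: measurableC.
Qed.

(** The part of [Rplus] beyond [Abar] is null for [Phi], so a bound on [0, Abar] suffices although
    [EA] integrates over [Rplus]. *)
Lemma EA_integrable (g : R -> R) (K : R) : measurable_fun Rplus g ->
  (forall a, 0 <= a -> a <= Abar -> `|g a| <= K) ->
  Phi.-integrable Rplus (EFin \o g).
Proof.
move=> mg gK; apply/integrableP; split; first exact/measurable_EFinP.
rewrite (ge0_negligible_integral measurable_RplusD)//.
- rewrite RplusD; apply: (@le_lt_trans _ _ (\int[Phi]_(a in `[0%R, Abar]) K%:E)%E).
    apply: ge0_le_integral => //.
    + apply: (measurable_funS (@measurable_Rplus R)).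
        by move=> a /=; rewrite RplusE in_itv/= => /andP[].
      by apply: measurableT_comp => //; exact/measurable_EFinP.
    + by move=> a /=; rewrite in_itv/= => /andP[a0 aA]; rewrite lee_fin gK.
  rewrite integral_cst//=; case: PhiP => + _; rewrite /= => ->.
  by rewrite mule1 ltry.
- exact: measurable_Rplus.
- by apply: measurableT_comp => //; exact/measurable_EFinP.
- exact: arrival_RplusD.
Qed.

Lemma le_EA (g h : R -> R) :
  Phi.-integrable Rplus (EFin \o g) -> Phi.-integrable Rplus (EFin \o h) ->
  (forall a, 0 <= a -> a <= Abar -> g a <= h a) -> EA Phi g <= EA Phi h.
Proof.
move=> ig ih gh.
have EAE f : Phi.-integrable Rplus (EFin \o f) ->
    EA Phi f = \int[Phi]_(a in `[0, Abar]) f a.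
  move=> fi; congr fine.
  by rewrite (negligible_integral measurable_RplusD _ fi) ?RplusD//;
    [exact: measurable_Rplus|exact: arrival_RplusD].
have S f : Phi.-integrable Rplus (EFin \o f) ->
    Phi.-integrable `[0%R, Abar]%classic (EFin \o f).
  apply: integrableS => //; first exact: measurable_Rplus.
  by move=> a /=; rewrite RplusE in_itv/= => /andP[].
rewrite !EAE//; apply: le_Rintegral => //; [exact: S|exact: S|].
by move=> a /=; rewrite in_itv/= => /andP[]; exact: gh.
Qed.

Lemma EA_cst (K : R) : EA Phi (fun=> K) = K.
Proof.
rewrite /EA Rintegral_cst; last exact: measurable_Rplus.
by move: arrival_Rplus; rewrite /= => ->; rewrite mulr1.
Qed.

Lemma EA_norm_le (g : R -> R) (K : R) : measurable_fun Rplus g ->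
  (forall a, 0 <= a -> a <= Abar -> `|g a| <= K) -> `|EA Phi g| <= K.
Proof.
move=> mg gK.
have iK (c : R) : Phi.-integrable Rplus (EFin \o cst c).
  by apply: (@EA_integrable _ `|c|).
have ig := EA_integrable mg gK.
rewrite ler_norml; apply/andP; split.
- rewrite -[leLHS]EA_cst; apply: le_EA ig _ => [|a a0 aA]; first exact: iK.
  by have := gK a a0 aA; rewrite ler_norml => /andP[].
- rewrite -[leRHS]EA_cst; apply: le_EA ig _ _ => [|a a0 aA]; first exact: iK.
  by have := gK a a0 aA; rewrite ler_norml => /andP[].
Qed.

Lemma measurable_shift (f : R -> R) q : measurable_fun Rplus f -> 0 <= q ->
  measurable_fun Rplus (fun a => f (q + a)).
Proof.
move=> mf q0; apply: (measurable_comp (@measurable_Rplus R)) mf _ => //.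
  by move=> _ [a + <-]; rewrite !RplusE; exact: addr_ge0.
by apply: measurable_funD.
Qed.

(** Tonelli's theorem for a parameter integral. The zero extension of [f] and the indicator of
    [Rplus] in the second variable make the integrand measurable and nonnegative on the whole
    plane. *)
Lemma measurable_EA_shift (f : R -> R) : measurable_fun Rplus f ->
  (forall q, 0 <= q -> 0 <= f q) ->
  measurable_fun Rplus (fun q => EA Phi (fun a => f (q + a))).
Proof.
move=> mf f0; pose h := f \_ Rplus.
have mh : measurable_fun setT h.
  by apply/(measurable_restrictT f (@measurable_Rplus R)).
have h0 q : 0 <= h q by rewrite /h patchE; case: ifPn => //; rewrite inE RplusE; exact: f0.
pose F (z : R * R) : \bar R := (h (z.1 + z.2) * \1_Rplus z.2)%:E.
have mF : measurable_fun setT F.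
  apply/measurable_EFinP; apply: measurable_funM.
    apply: measurableT_comp => //; exact: measurable_funD.
  by apply: measurableT_comp measurable_snd; apply: measurable_indic; exact: measurable_Rplus.
have F0 z : (0 <= F z)%E by rewrite lee_fin mulr_ge0.
have mint := @measurable_fun_fubini_tonelli_F _ _ _ _ _ Phi _ mF F0.
apply: (eq_measurable_fun (fine \o (fun q => \int[Phi]_a F (q, a))%E)).
  move=> q; rewrite inE RplusE => q0 /=; rewrite /EA /Rintegral; congr fine.
  rewrite [RHS]integral_mkcond; apply: eq_integral => a _.
  rewrite /F/= patchE indicE; case: ifPn => aP; last by rewrite mulr0.
  move: aP; rewrite inE RplusE => a0.
  by rewrite mulr1 /h patchE ifT// inE RplusE addr_ge0.
by apply: measurable_funTS; apply: measurableT_comp.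
Qed.

End arrivals.

(** * Independent pairs and averaging over a uniform draw *)

Lemma integral_probability_cst d (T : measurableType d) (R : realType)
  (P : probability T R) (k : \bar R) : (\int[P]_w cst k w = k)%E.
Proof.
rewrite integral_cst//; have := probability_setT P; rewrite /= => ->.
by rewrite mule1.
Qed.

Section independent_pair.
Context d (Omega : measurableType d) (R : realType) (P : probability Omega R).
Context d1 d2 (T1 : measurableType d1) (T2 : measurableType d2).

(** Both sides, as functions of [S], are finite measures: the image of P restricted to B, and the
    image of P scaled by P B. They agree on rectangles, a generating family stable under
    intersection. *)
Lemma indep_event_pair (X : Omega -> T1) (Z : Omega -> T2) (B : set Omega) :
  measurable_fun setT X -> measurable_fun setT Z -> measurable B ->
  (forall S F, measurable S -> measurable F ->
    P ((X @^-1` S `&` Z @^-1` F) `&` B) = (P (X @^-1` S `&` Z @^-1` F) * P B)%E) ->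
  forall S : set (T1 * T2), measurable S ->
    P ((fun w => (X w, Z w)) @^-1` S `&` B)
    = (P ((fun w => (X w, Z w)) @^-1` S) * P B)%E.
Proof.
move=> mX mZ mB indep S mS.
pose XZ w := (X w, Z w); have mXZ : measurable_fun setT XZ.
  exact: measurable_fun_pair.
pose m1 := @measure_function_pushforward__canonical__measure_function_Measure
  _ _ _ _ _ (mrestr P mB) XZ mXZ.
have PB0 : 0 <= fine (P B) by rewrite fine_ge0.
pose m2 := mscale (NngNum PB0)
  (@measure_function_pushforward__canonical__measure_function_Measure
    _ _ _ _ _ P XZ mXZ).
have PBE : P B = (fine (P B))%:E by rewrite fineK// fin_num_measure.
have m1m2 : forall S, measurable S -> m1 S = m2 S.
  pose G : set (set (T1 * T2)) := [set A `*` B | A in measurable & B in measurable].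
  apply: (measure_unique G (fun=> setT)).
  - by rewrite measurable_prod_measurableType; congr (<<s _ >>).
  - move=> _ _ [A1 mA1 [B1 mB1 <-]] [A2 mA2 [B2 mB2 <-]]; rewrite -setXI.
    by exists (A1 `&` A2); [exact: measurableI|exists (B1 `&` B2) => //; exact: measurableI].
  - by move=> _; exists setT => //; exists setT => //; rewrite setXTT.
  - by rewrite bigcup_const//; exists 0%N.
  - move=> _ [A mA [F mF <-]].
    by rewrite /m1/m2/= /mscale/= /pushforward/mrestr/= -PBE muleC; exact: indep.
  - move=> _; rewrite /m1/=/pushforward/mrestr preimage_setT setTI.
    by rewrite (le_lt_trans (probability_le1 _ _))// ltry.
have := m1m2 _ mS.
by rewrite /m1/m2/= /mscale/= /pushforward/mrestr/= -PBE muleC.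
Qed.

(** By independence the joint law is the product of the two laws; Tonelli then integrates [Z] out
    with [X] frozen. *)
Lemma integral_indep_pair (X : Omega -> T1) (Z : {RV P >-> T2}) (h : T1 * T2 -> \bar R) :
  measurable_fun setT X ->
  (forall S F, measurable S -> measurable F ->
    P (X @^-1` S `&` Z @^-1` F) = (P (X @^-1` S) * P (Z @^-1` F))%E) ->
  measurable_fun setT h -> (forall z, 0 <= h z)%E ->
  (\int[P]_w h (X w, Z w) = \int[P]_w \int[distribution P Z]_z h (X w, z))%E.
Proof.
move=> mX indep mh h0.
pose X' : {RV P >-> T1} := mfun_Sub (mem_set mX).
pose XZ w := (X' w, Z w); have mXZ : measurable_fun setT XZ.
  exact: measurable_fun_pair.
pose XZ' : {RV P >-> (T1 * T2)%type} := mfun_Sub (mem_set mXZ).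
transitivity (\int[distribution P XZ']_z h z)%E.
  by rewrite ge0_integral_distribution.
transitivity (\int[distribution P X' \x distribution P Z]_z h z)%E.
  apply: eq_measure_integral => S mS _; apply/esym.
  by apply: product_measure_unique => // A F mA mF; exact: indep.
rewrite fubini_tonelli1// ge0_integral_distribution//.
- exact: measurable_fun_fubini_tonelli_F.
- by move=> x; exact: integral_ge0.
Qed.

End independent_pair.

Lemma uniform_prob_le (R : realType) (c : R) : 0 <= c -> c <= 1 ->
  uniform_prob (@ltr01 R) `]-oo, c]%classic = c%:E.
Proof.
move=> c0 c1; rewrite -[X in uniform_prob _ X]setIT -integral_indic//.
rewrite integral_uniform//; last first.
  by apply: measurableT_comp => //; exact: measurable_indic.
rewrite subr0 invr1 mul1e integral_indic//.
have -> : `]-oo, c]%classic `&` `[0, 1]%classic = `[0, c]%classic :> set R.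
  apply/seteqP; split => x /=; rewrite !in_itv/=.
    by case=> -> /andP[->].
  by move=> /andP[-> xc]; rewrite xc (le_trans xc).
have := lebesgue_measure_itv `[0, c]; rewrite /= lte_fin => ->.
case: ltP; first by rewrite sube0.
by move=> c0'; congr EFin; apply/le_anti/andP.
Qed.

(** Used with [c] the winning probability, [a] the continuation after a win and [b] the one after a
    loss. *)
Lemma integral_threshold (R : realType) (mu : probability R R) (c : R) (a b : \bar R) :
  mu `]-oo, c]%classic = c%:E -> (0 <= a)%E -> (0 <= b)%E ->
  (\int[mu]_u (if (u <= c)%R then a else b) = c%:E * a + (1 - c)%:E * b)%E.
Proof.
move=> muE a0 b0.
have mle : measurable (`]-oo, c]%classic : set R) by exact: measurable_itv.
have mif : measurable_fun setT (fun u : R => if (u <= c)%R then a else b).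
  by apply: measurable_fun_ifT => //; exact: measurable_fun_ler.
rewrite -(setUv `]-oo, c]%classic) ge0_integral_setU//; last 4 first.
- exact: measurableC.
- by rewrite setUv.
- by move=> u _; case: ifP.
- by apply/disj_setPCl.
congr (_ + _)%E.
- rewrite (eq_integral (cst a)); last first.
    by move=> u; rewrite inE/= in_itv/= => ->.
  by rewrite integral_cst// muleC; congr (_ * _)%E.
- rewrite (eq_integral (cst b)); last first.
    by move=> u; rewrite inE/= in_itv/= => /negP/negbTE ->.
  rewrite integral_cst; last exact: measurableC.
  rewrite muleC; congr (_ * _)%E; rewrite EFinB -muE.
  exact: probability_setC.
Qed.

(** * Driving noise, independence of the queue from the future, one-step formula *)

Section noise.
Context {R : realType} (d : measure_display) (Omega : measurableType d)
  (P : probability Omega R) (Phi : probability R R) (A U : nat -> {RV P >-> R}).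
Hypothesis noiseP : driving_noise Phi A U.

(* The noise variables in the order in which they are used: U 0, A 0, U 1, ... *)
Definition noise (b : bool) (t : nat) : {RV P >-> R} := if b then A t else U t.
Definition stage (b : bool) (t : nat) : nat := t.*2 + b.

(** Cylinders of exactly the shape that [driving_noise] factors; an entry [setT] leaves its variable
    free. *)
Definition noise_event (m : nat) (H : bool -> nat -> set R) : set Omega :=
  \bigcap_(t < m) (noise true t @^-1` H true t `&` noise false t @^-1` H false t).

(** Independence from the noise of rank at least [k], tested on cylinders free below rank [k]. The
    condition [k <= m.*2] keeps all ranks below [k] inside the window, where a free entry can still
    be filled. *)
Definition indep_future (k : nat) (X : Omega -> R) :=
  forall (m : nat) (H : bool -> nat -> set R),
    (forall b t, measurable (H b t)) -> (k <= m.*2)%N ->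
    (forall b t, (stage b t < k)%N -> H b t = setT) ->
    forall S, measurable S ->
      P (X @^-1` S `&` noise_event m H) = (P (X @^-1` S) * P (noise_event m H))%E.

Lemma measurable_noise_preimage b t (S : set R) : measurable S ->
  measurable (noise b t @^-1` S).
Proof. by move=> mS; rewrite -[X in measurable X]setTI; exact: measurable_funP. Qed.

Lemma measurable_noise_event m H : (forall b t, measurable (H b t)) ->
  measurable (noise_event m H).
Proof.
move=> mH; apply: bigcap_measurableType => t _.
by apply: measurableI; exact: measurable_noise_preimage.
Qed.

Definition noise_upd (H : bool -> nat -> set R) b t (S : set R) b' t' :=
  if (b' == b) && (t' == t) then S else H b' t'.

Lemma noise_event_upd m H b t S : (t < m)%N -> H b t = setT ->
  noise_event m (noise_upd H b t S) = noise b t @^-1` S `&` noise_event m H.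
Proof.
move=> tm Ht; apply/seteqP; split=> w.
  move=> h; split.
    by have [] := h t tm; rewrite /noise_upd !eqxx; case: (b).
  move=> s sm; have [] := h s sm; rewrite /noise_upd.
  have [->|_] := eqVneq s t; last by rewrite !andbF.
  by move: Ht; case: (b) => /= ->.
move=> [wS h] s sm; have [] := h s sm; rewrite /noise_upd.
have [->|_] := eqVneq s t; last by rewrite !andbF.
by move: wS; case: (b).
Qed.

Lemma prob_noise_event m H : (forall b t, measurable (H b t)) ->
  P (noise_event m H) = (\prod_(t < m)
    (P (noise true t @^-1` H true t) * P (noise false t @^-1` H false t)))%E.
Proof. by move=> mH; case: noiseP => _ _ _; exact. Qed.

(** Filling a free entry yields another cylinder; in the product formula only the factor of index
    [t] changes, where the free entry had contributed 1. *)
Lemma prob_noise_event_upd m H b t S : (forall b t, measurable (H b t)) ->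
  measurable S -> (t < m)%N -> H b t = setT ->
  P (noise b t @^-1` S `&` noise_event m H)
  = (P (noise b t @^-1` S) * P (noise_event m H))%E.
Proof.
move=> mH mS tm Ht; rewrite -noise_event_upd// !prob_noise_event//; last first.
  by move=> b' t'; rewrite /noise_upd; case: ifP.
rewrite (bigD1 (Ordinal tm))//= [in RHS](bigD1 (Ordinal tm))//= muleA.
congr (_ * _)%E.
  rewrite /noise_upd !eqxx !andbT; move: Ht; case: b => /= Ht.
    by rewrite Ht preimage_setT probability_setT mul1e.
  by rewrite Ht preimage_setT probability_setT mule1 muleC.
apply: eq_bigr => s st; rewrite /noise_upd.
have -> : (s == t :> nat) = false.
  by apply/negbTE; apply: contra st => /eqP st; apply/eqP/val_inj.
by rewrite !andbF.
Qed.

Lemma indep_future_cst q : indep_future 0 (fun=> q).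
Proof.
move=> m H mH _ _ S mS; have [Sq|Sq] := pselect (S q).
  rewrite (_ : _ @^-1` S = setT); last by apply/seteqP; split.
  by rewrite setTI probability_setT mul1e.
rewrite (_ : _ @^-1` S = set0); last by apply/seteqP; split.
by rewrite set0I measure0 mul0e.
Qed.

(** The condition on [noise b t] is absorbed into the cylinder, the independence of [X] is applied,
    and the condition is split off again. *)
Lemma indep_future_pair b t X S F B :
  indep_future (stage b t) X -> measurable S -> measurable F ->
  (exists m H, [/\ (forall b t, measurable (H b t)), (t < m)%N,
    (forall b' t', (stage b' t' < (stage b t).+1)%N -> H b' t' = setT) &
    B = noise_event m H]) ->
  P ((X @^-1` S `&` noise b t @^-1` F) `&` B)
  = (P (X @^-1` S) * P (noise b t @^-1` F) * P B)%E.
Proof.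
move=> iX mS mF [m [H [mH tm HT ->]]].
have Ht : H b t = setT by apply: HT.
rewrite -setIA -noise_event_upd// iX//; last 3 first.
- by move=> b' t'; rewrite /noise_upd; case: ifP.
- by rewrite /stage; case: (b); lia.
- move=> b' t' b't'; rewrite /noise_upd ifF; last first.
    by apply/negP => /andP[/eqP b'b /eqP t't]; move: b't'; rewrite b'b t't ltnn.
  by apply: HT; exact: ltnW.
by rewrite noise_event_upd// prob_noise_event_upd// muleA.
Qed.

Lemma noise_event_setT m : noise_event m (fun _ _ => setT) = setT.
Proof. by apply/seteqP; split. Qed.

Lemma indep_future_noise b t X S F :
  indep_future (stage b t) X -> measurable S -> measurable F ->
  P (X @^-1` S `&` noise b t @^-1` F) = (P (X @^-1` S) * P (noise b t @^-1` F))%E.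
Proof.
move=> iX mS mF; have := @indep_future_pair b t X S F setT iX mS mF.
rewrite setIT probability_setT mule1; apply.
by exists t.+1, (fun _ _ => setT); split => //; rewrite noise_event_setT.
Qed.

(** Consuming one noise variable raises the rank by one. Rectangles in (X, noise b t) come from
    [indep_future_pair], general events from [indep_event_pair]. *)
Lemma indep_future_next b t X (phi : R * R -> R) :
  measurable_fun setT X -> measurable_fun setT phi ->
  indep_future (stage b t) X ->
  indep_future (stage b t).+1 (fun w => phi (X w, noise b t w)).
Proof.
move=> mX mphi iX m H mH tm HT S mS.
have tm' : (t < m)%N by move: tm; rewrite /stage; case: (b); lia.
have mE := measurable_noise_event m mH.
have mphiS : measurable (phi @^-1` S) by rewrite -[X in measurable X]setTI; exact: mphi.
suff indep S' F : measurable S' -> measurable F ->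
    P ((X @^-1` S' `&` noise b t @^-1` F) `&` noise_event m H)
    = (P (X @^-1` S' `&` noise b t @^-1` F) * P (noise_event m H))%E.
  exact: (indep_event_pair mX (measurable_funP (noise b t)) mE indep mphiS).
move=> mS' mF; rewrite [in RHS](indep_future_noise iX)//.
by apply: indep_future_pair => //; exists m, H.
Qed.

Context (p theta : R -> R).
Hypotheses (mp : measurable_fun setT p) (mtheta : measurable_fun setT theta)
  (p_ge0 : forall x, 0 <= p x) (p_le1 : forall x, p x <= 1).
Local Notation Q q t := (queue p theta (fun s => A s) (fun s => U s) q t).

(** Half a slot: the queue after the auction and before the arrival. With it each half consumes a
    single noise variable. *)
Definition departure (z : R * R) : R :=
  if z.2 <= p (theta z.1) then pos (z.1 - 1) else z.1.

Lemma measurable_departure : measurable_fun setT departure.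
Proof.
apply: measurable_fun_ifT => //; last first.
  by apply: measurable_maxr => //; exact: measurable_funB.
apply: measurable_fun_ler => //.
by do 2 apply: measurableT_comp => //.
Qed.

Lemma measurable_queue q t : measurable_fun setT (Q q t).
Proof.
elim: t => [|t IH]; first exact: measurable_cst.
have mQU := measurable_fun_pair IH (measurable_funP (U t)).
exact: measurable_funD (measurableT_comp measurable_departure mQU) (measurable_funP (A t)).
Qed.

Lemma measurable_departed q t :
  measurable_fun setT (fun w => departure (Q q t w, U t w)).
Proof.
have mQU := measurable_fun_pair (measurable_queue q t) (measurable_funP (U t)).
exact: (measurableT_comp measurable_departure mQU).
Qed.

(** A slot raises the rank by two: [departure] consumes [U t], the addition consumes [A t]. *)
Lemma queue_indep_future q t : indep_future (stage false t) (Q q t).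
Proof.
elim: t => [|t IH]; first exact: indep_future_cst.
have iY := indep_future_next (measurable_queue q t) measurable_departure IH.
have -> : stage false t.+1 = (stage true t).+1 by rewrite /stage; lia.
have sT : (stage false t).+1 = stage true t by rewrite /stage; lia.
rewrite sT in iY.
apply: (@indep_future_next true t _ (fun z => z.1 + z.2) _ _ iY).
  exact: measurable_departed.
exact: measurable_funD.
Qed.

(** The Markov property in integrated form. The later variable [A t] is integrated out first, with
    the departed queue frozen; then [U t], with the queue frozen, splits the result into loss and
    win. *)
Lemma integral_queueS (h : R -> \bar R) q t : measurable_fun setT h ->
  (forall x, 0 <= h x)%E ->
  (\int[P]_w h (Q q t.+1 w) =
   \int[P]_w ((1 - p (theta (Q q t w)))%:E * (\int[Phi]_a h (Q q t w + a)%R)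
     + (p (theta (Q q t w)))%:E * (\int[Phi]_a h (pos (Q q t w - 1) + a)%R)))%E.
Proof.
move=> mh h0; pose H y := (\int[Phi]_a h (y + a)%R)%E.
have mhD : measurable_fun setT (fun z : R * R => h (z.1 + z.2)%R).
  by apply: measurableT_comp => //; exact: measurable_funD.
have mH : measurable_fun setT H.
  exact: (@measurable_fun_fubini_tonelli_F _ _ _ _ _ Phi _ mhD).
have H0 y : (0 <= H y)%E by exact: integral_ge0.
have [_ lawA lawU _] := noiseP.
have iQ := @queue_indep_future q t; have mQ := @measurable_queue q t.
transitivity (\int[P]_w H (departure (Q q t w, U t w)))%E.
  have iY := indep_future_next (measurable_queue q t) measurable_departure iQ.
  have sT : (stage false t).+1 = stage true t by rewrite /stage; lia.
  rewrite sT in iY.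
  have := integral_indep_pair (measurable_departed q t)
    (fun S F => @indep_future_noise true t _ S F iY) mhD (fun z => h0 _).
  move=> ->; apply: eq_integral => w _.
  by apply: eq_measure_integral => S mS _; exact: lawA.
have mHd : measurable_fun setT (fun z => H (departure z)).
  by apply: measurableT_comp => //; exact: measurable_departure.
rewrite (integral_indep_pair (measurable_queue q t)
  (fun S F => @indep_future_noise false t _ S F iQ) mHd (fun z => H0 _)).
apply: eq_integral => w _.
rewrite addeC /= -(@integral_threshold _ (distribution P (U t)) (p (theta (Q q t w)))) ?H0//.
  by apply: eq_integral => u _; rewrite /departure/=; case: ifP.
exact: etrans (lawU t _ (measurable_itv _)) (uniform_prob_le _ _).
Qed.

End noise.

(** * The Bellman operator in the equivalent norm and its fixed point *)

Section bellman.
Context {R : realType} (M : nat) (beta Abar E D g : R) (Phi : probability R R)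
  (C rho W : R -> R).
Hypotheses (M_ge2 : (2 <= M)%N) (beta_gt0 : 0 < beta)
  (PhiP : arrival_law Abar Phi) (rhoP : bid_distribution E rho)
  (C_ge0 : forall q, Rplus q -> 0 <= C q)
  (mC : measurable_fun Rplus C)
  (D_ge1 : 1 <= D) (g_ge0 : 0 <= g) (rate_lt1 : beta * g < 1)
  (mW : measurable_fun Rplus W)
  (W_equiv : forall q, 0 <= q -> weight C q <= W q <= D * weight C q)
  (W_ndecr : forall x y, 0 <= x -> x <= y -> W x <= W y)
  (W_growth : forall q, 0 <= q -> W (q + Abar) <= g * W q).
Local Notation p := (win_prob M rho).
Local Notation r := (payment M rho).
Local Notation T := (bellman M beta Phi C rho).

(** The closed ball of radius [K] in the [W]-norm, as a pointwise predicate. *)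
Definition dominated (K : R) (f : R -> R) :=
  forall q, 0 <= q -> `|f q| <= K * W q.

Lemma W_ge1 q : 0 <= q -> 1 <= W q.
Proof. by move=> /W_equiv/andP[+ _]; apply: le_trans; exact: weight_ge1. Qed.

Lemma W_ge0 q : 0 <= q -> 0 <= W q.
Proof. by move=> /W_ge1; apply: le_trans. Qed.

Lemma wnorm_dominated (f : R -> R) K : 0 <= K -> (wnorm C f <= K%:E)%E ->
  dominated K f.
Proof.
move=> K0 /wnorm_leP fK q q0; apply: (le_trans (fK q q0)).
by rewrite ler_wpM2l//; have /andP[] := W_equiv q0.
Qed.

Lemma dominated_wnorm (f : R -> R) K : 0 <= K -> dominated K f ->
  (wnorm C f <= (K * D)%:E)%E.
Proof.
move=> K0 fK; apply/wnorm_leP => q q0; apply: (le_trans (fK q q0)).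
by rewrite -mulrA ler_wpM2l//; have /andP[] := W_equiv q0.
Qed.

Lemma wspace_dominated (f : R -> R) : wspace C f ->
  exists2 K, 0 <= K & dominated K f.
Proof.
case=> _ _ /wnorm_fin[K K0 fK]; exists K => //; apply: wnorm_dominated => //.
by rewrite fK.
Qed.

Lemma dominated_wspace (f : R -> R) K : measurable_fun Rplus f ->
  (forall q, 0 <= q -> 0 <= f q) -> 0 <= K -> dominated K f -> wspace C f.
Proof.
move=> mf f0 K0 fK; split=> [//|q|]; first by rewrite RplusE; exact: f0.
exact: le_lt_trans (dominated_wnorm K0 fK) (ltry _).
Qed.

Section shift.
Context (f : R -> R) (K y q : R).
Hypotheses (K0 : 0 <= K) (fK : dominated K f) (y0 : 0 <= y) (yq : y <= q).

(** Monotonicity of [W] moves y + a up to q + Abar, at the price [g]. The continuation states y = q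
    and y = pos (q - 1) both satisfy y <= q and share this bound. *)
Let shift_bound a : 0 <= a -> a <= Abar -> `|f (y + a)| <= K * (g * W q).
Proof.
move=> a0 aA; apply: (le_trans (fK (addr_ge0 y0 a0))); rewrite ler_wpM2l//.
apply: le_trans (W_growth (le_trans y0 yq)).
by apply: W_ndecr; [exact: addr_ge0|exact: lerD].
Qed.

Lemma shift_integrable : measurable_fun Rplus f ->
  Phi.-integrable Rplus (EFin \o (fun a => f (y + a))).
Proof.
move=> mf; apply: (EA_integrable PhiP) shift_bound.
exact: measurable_shift.
Qed.

Lemma EA_shift_norm_le : measurable_fun Rplus f ->
  `|EA Phi (fun a => f (y + a))| <= K * (g * W q).
Proof.
move=> mf; apply: (EA_norm_le PhiP) shift_bound.
exact: measurable_shift.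
Qed.

End shift.

Lemma wspace_shift_integrable f y : wspace C f -> 0 <= y ->
  Phi.-integrable Rplus (EFin \o (fun a => f (y + a))).
Proof.
move=> wf y0; have [K K0 fK] := wspace_dominated wf.
by apply: (shift_integrable K0 fK y0 (lexx y)); case: wf.
Qed.

Lemma EA_shiftB f h y : wspace C f -> wspace C h -> 0 <= y ->
  EA Phi (fun a => (f \- h) (y + a)) =
  EA Phi (fun a => f (y + a)) - EA Phi (fun a => h (y + a)).
Proof.
move=> wf wh y0; rewrite /EA -RintegralB//; first exact: measurable_Rplus.
- exact: wspace_shift_integrable.
- exact: wspace_shift_integrable.
Qed.

Lemma DeltaE f q : wspace C f -> 0 <= q ->
  Delta Phi f q = EA Phi (fun a => f (q + a)) - EA Phi (fun a => f (pos (q - 1) + a)).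
Proof.
move=> wf q0; rewrite /Delta/EA RintegralB//; first exact: measurable_Rplus.
- exact: wspace_shift_integrable.
- by apply: wspace_shift_integrable => //; exact: pos_ge0.
Qed.

(** Cost of bidding [x] for one slot and then paying [f]. The continuation is grouped as a convex
    combination of loss and win, so its bounds follow from those of the two terms. *)
Definition lookahead (f : R -> R) (q x : R) : R :=
  C q + r x + beta * ((1 - p x) * EA Phi (fun a => f (q + a))
                      + p x * EA Phi (fun a => f (pos (q - 1) + a))).

Lemma bellman_argmin f q : wspace C f -> 0 <= q ->
  T f q = lookahead f q (beta * pos (Delta Phi f q)).
Proof.
move=> wf q0; rewrite /bellman (inf_payment M_ge2 rhoP).
have -> : pos (beta * Delta Phi f q) = beta * pos (Delta Phi f q).
  by rewrite /pos maxr_pMr ?mulr0// ltW.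
by rewrite /lookahead DeltaE//; ring.
Qed.

Lemma bellman_le_lookahead f q x : wspace C f -> 0 <= q -> 0 <= x ->
  T f q <= lookahead f q x.
Proof.
move=> wf q0 x0; rewrite /bellman (inf_payment M_ge2 rhoP).
have -> : lookahead f q x = C q + beta * EA Phi (fun a => f (q + a))
    + (r x - p x * (beta * Delta Phi f q)).
  by rewrite /lookahead DeltaE//; ring.
by rewrite lerD2l; exact: payment_argmin M_ge2 rhoP _ _ x0.
Qed.

(** Measurability and sign are read off the explicit minimiser, the upper bound off the bid 0, which
    costs nothing and never wins. *)
Lemma bellman_wspace f : wspace C f -> wspace C (T f).
Proof.
move=> wf; have [mf f0 _] := wf; have [K K0 fK] := wspace_dominated wf.
have f0' q : 0 <= q -> 0 <= f q by rewrite -RplusE; exact: f0.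
pose h q := EA Phi (fun a => f (q + a)).
have mh : measurable_fun Rplus h by exact: measurable_EA_shift.
have mh1 : measurable_fun Rplus (fun q => h (pos (q - 1))).
  apply: (measurable_comp (@measurable_Rplus R)) mh _.
    by move=> _ [q _ <-]; rewrite RplusE; exact: pos_ge0.
  by apply: measurable_maxr => //; exact: measurable_funB.
have h0 q : 0 <= q -> 0 <= h q.
  move=> q0; apply: Rintegral_ge0 => a; rewrite RplusE => a0.
  by apply: f0'; exact: addr_ge0.
have mT : measurable_fun Rplus (T f).
  pose th q := beta * pos (h q - h (pos (q - 1))).
  have mth : measurable_fun Rplus th.
    apply: measurable_funM => //.
    by apply: measurable_maxr => //; exact: measurable_funB.
  apply: (@eq_measurable_fun _ _ _ _ _ (fun q => C q + r (th q)
      + beta * ((1 - p (th q)) * h q + p (th q) * h (pos (q - 1))))).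
    by move=> q; rewrite inE RplusE => q0; rewrite bellman_argmin// /lookahead DeltaE.
  have mp : measurable_fun Rplus (p \o th).
    by apply: measurableT_comp mth; exact: measurable_win_prob rhoP.
  apply: measurable_funD.
    apply: measurable_funD => //.
    by apply: measurableT_comp mth; exact: measurable_payment rhoP.
  apply: measurable_funM => //; apply: measurable_funD; apply: measurable_funM => //.
  exact: measurable_funB.
have T0 q : 0 <= q -> 0 <= T f q.
  move=> q0; rewrite bellman_argmin// /lookahead.
  have th0 : 0 <= beta * pos (Delta Phi f q) by rewrite mulr_ge0 ?pos_ge0 ?ltW.
  rewrite addr_ge0//.
    by apply: addr_ge0; [apply: C_ge0; rewrite RplusE|exact: payment_ge0 rhoP _ th0].
  rewrite mulr_ge0 ?(ltW beta_gt0)// addr_ge0// mulr_ge0//.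
  - by rewrite subr_ge0 (win_prob_le1 M rhoP).
  - exact: h0.
  - by rewrite (win_prob_ge0 M rhoP).
  - by apply: h0; exact: pos_ge0.
have K1 : 0 <= 1 + beta * (K * g).
  by rewrite addr_ge0// mulr_ge0 ?(ltW beta_gt0)// mulr_ge0.
apply: (dominated_wspace mT T0 K1) => q q0.
rewrite ger0_norm ?T0//; apply: le_trans (bellman_le_lookahead wf q0 (lexx 0)) _.
rewrite /lookahead (payment0 M) (win_prob0 M_ge2 rhoP) subr0 mul1r mul0r !addr0.
rewrite mulrDl mul1r; apply: lerD.
  have /andP[+ _] := W_equiv q0; apply: le_trans.
  by rewrite /weight le_max lexx.
rewrite -mulrA ler_wpM2l ?(ltW beta_gt0)// -mulrA.
apply: le_trans (EA_shift_norm_le K0 fK q0 (lexx q) mf); exact: ler_norm.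
Qed.

(** The minimising bid for [h] is tried for [f]: stage cost and payment cancel, and an average of f
    - h over the two continuation states remains. *)
Lemma bellman_lipschitz_le f h K q : wspace C f -> wspace C h -> 0 <= K ->
  dominated K (f \- h) -> 0 <= q -> T f q - T h q <= beta * g * K * W q.
Proof.
move=> wf wh K0 fhK q0; rewrite (bellman_argmin wh q0).
set x := beta * _; have x0 : 0 <= x by rewrite mulr_ge0 ?pos_ge0 ?ltW.
have := bellman_le_lookahead wf q0 x0.
have mfh : measurable_fun Rplus (f \- h).
  by case: wf => mf _ _; case: wh => mh _ _; exact: measurable_funB.
have := EA_shift_norm_le K0 fhK q0 (lexx q) mfh.
rewrite EA_shiftB// => /(le_trans (ler_norm _)) h1.
have := EA_shift_norm_le K0 fhK (pos_ge0 _) (pos_subr1_le q0) mfh.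
rewrite EA_shiftB ?pos_ge0// => /(le_trans (ler_norm _)) h2.
have p0 := win_prob_ge0 M rhoP x.
have p1 : 0 <= 1 - p x by rewrite subr_ge0 (win_prob_le1 M rhoP).
move: (ler_wpM2l p1 h1) (ler_wpM2l p0 h2); rewrite /lookahead => e1 e2 e3.
have := ler_wpM2l (ltW beta_gt0) (lerD e1 e2); lra.
Qed.

Lemma bellman_lipschitz f h K : wspace C f -> wspace C h -> 0 <= K ->
  dominated K (f \- h) -> dominated (beta * g * K) (T f \- T h).
Proof.
move=> wf wh K0 fhK q q0 /=; rewrite ler_norml lerNl opprB.
rewrite !bellman_lipschitz_le// => y y0.
by rewrite /= distrC; exact: fhK.
Qed.

Lemma iter_bellman_wspace n f : wspace C f -> wspace C (iter n T f).
Proof. by move=> wf; elim: n => //= n; exact: bellman_wspace. Qed.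

Lemma rate_ge0 : 0 <= beta * g. Proof. by rewrite mulr_ge0// ltW. Qed.

Lemma iter_bellman_lipschitz n f h K : wspace C f -> wspace C h -> 0 <= K ->
  dominated K (f \- h) ->
  dominated ((beta * g) ^+ n * K) (iter n T f \- iter n T h).
Proof.
move=> wf wh K0 fhK; elim: n => [|n IH]; first by rewrite expr0 mul1r.
rewrite exprS -mulrA !iterS; apply: bellman_lipschitz => //.
- exact: iter_bellman_wspace.
- exact: iter_bellman_wspace.
- by rewrite mulr_ge0 ?exprn_ge0 ?rate_ge0.
Qed.

Lemma rate_norm_lt1 : `|beta * g| < 1.
Proof. by rewrite ger0_norm ?rate_ge0. Qed.

Lemma dominated_diff f h : wspace C f -> wspace C h ->
  exists2 K, 0 <= K & dominated K (f \- h).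
Proof.
move=> /wspace_dominated[K1 K10 fK] /wspace_dominated[K2 K20 hK].
exists (K1 + K2); first exact: addr_ge0.
move=> q q0 /=; rewrite mulrDl; apply: (le_trans (ler_normB _ _)).
by rewrite lerD ?fK ?hK.
Qed.

(** Comparing the two norms costs the factor [D] once, whatever the number of iterations; [j] is
    chosen with (beta g)^j D < 1. *)
Lemma iter_bellman_contraction :
  exists j, wcontraction C (iter j T).
Proof.
have D0 : 0 <= D by exact: le_trans D_ge1.
have [j jD] : exists j, (beta * g) ^+ j * D < 1.
  have /cvgrPdist_lt/(_ _ ltr01) : (beta * g) ^+ n * D @[n --> \oo] --> 0.
    rewrite -[X in _ --> X](mul0r D); apply: cvgMr_tmp; exact: (cvg_expr rate_norm_lt1).
  case=> N _ /(_ N (leqnn _)); rewrite /= sub0r normrN => /(le_lt_trans (ler_norm _)).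
  by exists N.
exists j; split; first exact: iter_bellman_wspace.
exists ((beta * g) ^+ j * D); split => //.
  by rewrite mulr_ge0 ?exprn_ge0 ?rate_ge0.
move=> f h wf wh; have [K' K'0 /(dominated_wnorm K'0) fhK'] := dominated_diff wf wh.
have [K K0 EK] := wnorm_fin (le_lt_trans fhK' (ltry _)).
rewrite EK -EFinM mulrAC; apply: dominated_wnorm.
  by rewrite mulr_ge0 ?exprn_ge0 ?rate_ge0.
by apply: iter_bellman_lipschitz => //; apply: wnorm_dominated => //; rewrite EK.
Qed.

Lemma geometric_eq0 (x c : R) : (forall n, `|x| <= (beta * g) ^+ n * c) -> x = 0.
Proof.
move=> xc; apply/eqP; rewrite -normr_le0.
have lim0 : (beta * g) ^+ n * c @[n --> \oo] --> 0.
  by rewrite -[X in _ --> X](mul0r c); apply: cvgMr_tmp; exact: (cvg_expr rate_norm_lt1).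
rewrite -(cvg_lim _ lim0)//; apply: limr_ge; first by apply/cvg_ex; exists 0.
exact: nearW.
Qed.

Lemma fixed_point_unique f h : wspace C f -> wspace C h ->
  (forall q, 0 <= q -> T f q = f q) -> (forall q, 0 <= q -> T h q = h q) ->
  forall q, 0 <= q -> f q = h q.
Proof.
move=> wf wh Tf Th q q0; have [K K0 fhK] := dominated_diff wf wh.
apply/eqP; rewrite -subr_eq0; apply/eqP/(@geometric_eq0 _ (K * W q)) => n.
rewrite mulrA; suff : dominated ((beta * g) ^+ n * K) (f \- h) by apply.
elim: n => [|n IH]; first by rewrite expr0 mul1r.
move=> y y0; rewrite exprS -(mulrA (beta * g)).
rewrite /= -(Tf y y0) -(Th y y0); apply: bellman_lipschitz => //.
by rewrite mulr_ge0 ?exprn_ge0 ?rate_ge0.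
Qed.

(** The Lipschitz bound with K = 0. *)
Lemma eq_bellman f h : wspace C f -> (forall q, 0 <= q -> f q = h q) ->
  forall q, 0 <= q -> T f q = T h q.
Proof.
move=> wf fh q q0; apply/eqP; rewrite -subr_eq0 -normr_le0.
rewrite -[leRHS](mul0r (W q)) -[X in X * W q](mulr0 (beta * g)).
apply: (bellman_lipschitz wf (eq_wspace fh wf)) => // y y0.
by rewrite /= fh// subrr normr0 mul0r.
Qed.

Lemma zero_wspace : wspace C (fun=> 0).
Proof.
by apply: (@dominated_wspace _ 0) => // q q0; rewrite normr0 mul0r.
Qed.

Local Notation u n := (iter n T (fun=> 0)).

Lemma iter_bellman_bounded : exists2 K, 0 <= K & forall m, dominated K (u m).
Proof.
have [K K0 TK] := wspace_dominated (bellman_wspace zero_wspace).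
have lam1 : 0 < 1 - beta * g by rewrite subr_gt0.
(* The bound is the fixed point of x -> beta g x + K, with [K] a bound for T 0, hence stable under
   iteration. *)
have KE : K / (1 - beta * g) = beta * g * (K / (1 - beta * g)) + K.
  by field; rewrite gt_eqF.
have K'0 : 0 <= K / (1 - beta * g) by rewrite divr_ge0// ltW.
exists (K / (1 - beta * g)) => //; elim=> [|m IH] q q0.
  by rewrite /= normr0 mulr_ge0// W_ge0.
rewrite iterS -[T _ q](subrK (T (fun=> 0) q)) (le_trans (ler_normD _ _))//.
rewrite KE mulrDl lerD ?TK//.
apply: (bellman_lipschitz (iter_bellman_wspace m zero_wspace) zero_wspace) => //.
by move=> y y0; rewrite /= subr0; exact: IH.
Qed.

(** The limit is taken pointwise, in the reals; the geometric rate times [W q] survives the limit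
    and makes the convergence uniform in the [W]-norm. *)
Lemma fixed_point_exists : exists2 fstar, wspace C fstar &
  forall q, 0 <= q -> T fstar q = fstar q.
Proof.
have [K K0 uK] := iter_bellman_bounded.
(* The two functions are the n-th iterates of T^m 0 and of 0, which are at [W]-distance at most
   [K]. *)
have uD n m q : 0 <= q -> `|u (n + m)%N q - u n q| <= (beta * g) ^+ n * (K * W q).
  move=> q0; rewrite iterD mulrA.
  have um0 : dominated K (u m \- u 0) by move=> y y0; rewrite /= subr0; exact: uK.
  exact: (iter_bellman_lipschitz n (iter_bellman_wspace m zero_wspace)
    zero_wspace K0 um0) q0.
pose fstar q := limn (fun n => u n q).
have cvg_u q : 0 <= q -> u n q @[n --> \oo] --> fstar q.
  move=> q0; apply/cauchy_cvgP/cauchy_exP => e e0.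
  have lim0 : (beta * g) ^+ n * (K * W q) @[n --> \oo] --> 0.
    rewrite -[X in _ --> X](mul0r (K * W q)); apply: cvgMr_tmp.
    exact: (cvg_expr rate_norm_lt1).
  move/cvgrPdist_lt : lim0 => /(_ _ e0)[N _ /(_ N (leqnn _))].
  rewrite /= sub0r normrN => /(le_lt_trans (ler_norm _)) Ne.
  exists (u N q); exists N => // n /= Nn; rewrite /ball/= distrC -(subnKC Nn).
  exact: le_lt_trans (uD _ _ _ q0) Ne.
have fu n q : 0 <= q -> `|fstar q - u n q| <= (beta * g) ^+ n * (K * W q).
  move=> q0; apply/ler_addgt0Pr => e e0.
  have /cvgrPdist_lt/(_ _ e0)[N _ /(_ (n + N)%N (leq_addl _ _))/= /ltW Ne] := cvg_u q q0.
  rewrite -(subrK (u (n + N)%N q) (fstar q)) -addrA addrC.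
  by rewrite (le_trans (ler_normD _ _))// lerD// uD.
have wfstar : wspace C fstar.
  apply: (@dominated_wspace _ K) => //.
  - apply: (@measurable_fun_cvg _ _ _ _ (fun n => u n)) => //.
    + by move=> n; have [] := iter_bellman_wspace n zero_wspace.
    + by move=> q; rewrite RplusE; exact: cvg_u.
  - move=> q q0; apply: limr_ge; first by apply/cvg_ex; exists (fstar q); exact: cvg_u.
    apply: nearW => n; have [_ + _] := iter_bellman_wspace n zero_wspace.
    by apply; rewrite RplusE.
  - by move=> q q0; have := fu 0%N q q0; rewrite /= subr0 expr0 mul1r.
exists fstar => // q q0; apply/eqP; rewrite -subr_eq0; apply/eqP.
(* The 2 counts the distances of T fstar and of fstar to the iterate of index n + 1. *)
apply: (@geometric_eq0 _ (2 * (K * W q))) => n.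
have n0 : 0 <= (beta * g) ^+ n by rewrite exprn_ge0// rate_ge0.
have wu := iter_bellman_wspace n zero_wspace.
have h1 : `|T fstar q - u n.+1 q| <= (beta * g) ^+ n.+1 * (K * W q).
  rewrite iterS exprS mulrA -(mulrA (beta * g)).
  apply: (bellman_lipschitz wfstar wu) => //; first exact: mulr_ge0.
  by move=> y y0; rewrite /= -mulrA; exact: fu.
have := fu n.+1 q q0; rewrite distrC => h2.
have h3 : (beta * g) ^+ n.+1 * (K * W q) <= (beta * g) ^+ n * (K * W q).
  rewrite ler_wpM2r ?mulr_ge0 ?W_ge0// exprS ler_piMl//; exact: ltW.
have := ler_distD (u n.+1 q) (T fstar q) (fstar q); lra.
Qed.

(** In the [W]-norm every single application contracts, so the full sequence converges, and not only
    along multiples of [j]. *)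
Lemma iter_bellman_cvg f fstar : wspace C f -> wspace C fstar ->
  (forall q, 0 <= q -> T fstar q = fstar q) ->
  wnorm C (iter n T f \- fstar) @[n --> \oo] --> 0%E.
Proof.
move=> wf ws Ts; have [K K0 fK] := dominated_diff wf ws.
have dom n : dominated ((beta * g) ^+ n * K) (iter n T f \- fstar).
  elim: n => [|n IH]; first by rewrite expr0 mul1r.
  move=> q q0; rewrite exprS -(mulrA (beta * g)) /= -(Ts q q0).
  apply: bellman_lipschitz => //; first exact: iter_bellman_wspace.
  by rewrite mulr_ge0 ?exprn_ge0 ?rate_ge0.
apply: (@squeeze_cvge _ _ _ _ (cst 0%E) _
    (fun n => ((beta * g) ^+ n * (K * D))%:E)).
- apply: nearW => n; rewrite wnorm_ge0/= mulrA; apply: dominated_wnorm => //.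
  by rewrite mulr_ge0 ?exprn_ge0 ?rate_ge0.
- exact: cvg_cst.
- apply: cvg_EFin; first exact: nearW.
  rewrite -[X in _ --> X](mul0r (K * D)); apply: cvgMr_tmp.
  exact: (cvg_expr rate_norm_lt1).
Qed.

Lemma measurable_EA_pos_shift f : wspace C f ->
  measurable_fun Rplus (fun q => EA Phi (fun a => f (pos (q - 1) + a))).
Proof.
move=> [mf f0 _]; have f0' q : 0 <= q -> 0 <= f q by rewrite -RplusE; exact: f0.
apply: (measurable_comp (@measurable_Rplus R)) (measurable_EA_shift Phi mf f0') _.
  by move=> _ [q _ <-]; rewrite RplusE; exact: pos_ge0.
by apply: measurable_maxr => //; exact: measurable_funB.
Qed.

Lemma argmin_policy f : wspace C f -> policy (fun q => beta * pos (Delta Phi f q)).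
Proof.
move=> wf; split; last by move=> q _; rewrite mulr_ge0 ?pos_ge0 ?ltW.
have [mf f0 _] := wf; have f0' q : 0 <= q -> 0 <= f q by rewrite -RplusE; exact: f0.
apply: (@eq_measurable_fun _ _ R R Rplus (fun q : R => beta * pos
    (EA Phi (fun a => f (q + a)) - EA Phi (fun a => f (pos (q - 1) + a))))).
  by move=> q; rewrite inE RplusE => q0; rewrite DeltaE.
apply: measurable_funM => //; apply: measurable_maxr => //; apply: measurable_funB.
  exact: measurable_EA_shift.
exact: measurable_EA_pos_shift.
Qed.

(** * Cost of a fixed policy and comparison with the fixed point *)

Section control.
Context (d : measure_display) (Omega : measurableType d) (P : probability Omega R)
  (A U : nat -> {RV P >-> R}) (theta : R -> R) (q : R).
Hypotheses (noiseP : driving_noise Phi A U) (theta_policy : policy theta) (q0 : 0 <= q).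
Local Notation Q t := (queue p theta (fun s => A s) (fun s => U s) q t).

Lemma queue_ge0 t w : 0 <= Q t w.
Proof.
have [A0 _ _ _] := noiseP.
by elim: t => //= t IH; rewrite addr_ge0//; case: ifP => // _; exact: pos_ge0.
Qed.

(** A policy is measurable on [Rplus] only; its zero extension is measurable everywhere and drives
    the same queue, which stays in [Rplus]. *)
Let th := theta \_ Rplus.

Lemma queue_restrict t w : Q t w = queue p th (fun s => A s) (fun s => U s) q t w.
Proof.
elim: t => //= t <-; have -> // : th (Q t w) = theta (Q t w).
by rewrite /th patchE ifT// inE RplusE queue_ge0.
Qed.

Lemma measurable_th : measurable_fun setT th.
Proof. by apply/(measurable_restrictT theta (@measurable_Rplus R)); case: theta_policy. Qed.

Lemma measurable_comp_queue (f : R -> R) t : measurable_fun Rplus f ->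
  measurable_fun setT (fun w => f (Q t w)).
Proof.
move=> mf; apply: (measurable_comp (@measurable_Rplus R)) mf _.
  by move=> _ [w _ <-]; rewrite RplusE; exact: queue_ge0.
apply: (@eq_measurable_fun _ _ _ _ _ (queue p th (fun s => A s) (fun s => U s) q t)).
  by move=> w _; rewrite queue_restrict.
exact: measurable_queue (measurable_win_prob M rhoP) measurable_th _ _.
Qed.

(** The conditional mean of f (Q_{t+1}) given Q_t = y under [theta]. *)
Definition next_mean (f : R -> R) (y : R) : R :=
  (1 - p (theta y)) * EA Phi (fun a => f (y + a))
  + p (theta y) * EA Phi (fun a => f (pos (y - 1) + a)).

Lemma measurable_next_mean f : wspace C f -> measurable_fun Rplus (next_mean f).
Proof.
move=> wf; have [mf f0 _] := wf.
have f0' y : 0 <= y -> 0 <= f y by rewrite -RplusE; exact: f0.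
have mpth : measurable_fun Rplus (p \o theta).
  by apply: measurableT_comp; [exact: measurable_win_prob rhoP|case: theta_policy].
apply: measurable_funD; apply: measurable_funM => //.
- exact: measurable_funB.
- exact: measurable_EA_shift.
- exact: measurable_EA_pos_shift.
Qed.

Lemma EA_shift_ge0 f y : wspace C f -> 0 <= y -> 0 <= EA Phi (fun a => f (y + a)).
Proof.
move=> [_ f0 _] y0; apply: Rintegral_ge0 => a; rewrite RplusE => a0.
by apply: f0; rewrite RplusE addr_ge0.
Qed.

Lemma next_mean_ge0 f y : wspace C f -> 0 <= y -> 0 <= next_mean f y.
Proof.
move=> wf y0; rewrite addr_ge0// mulr_ge0 ?EA_shift_ge0 ?pos_ge0//.
- by rewrite subr_ge0 (win_prob_le1 M rhoP).
- by rewrite (win_prob_ge0 M rhoP).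
Qed.

Lemma integral_shift f y : wspace C f -> 0 <= y ->
  (\int[Phi]_a ((f \_ Rplus) (y + a))%:E)%E = (EA Phi (fun a => f (y + a)))%:E.
Proof.
move=> wf y0; have [mf f0 _] := wf.
have mf' : measurable_fun setT (f \_ Rplus).
  by apply/(measurable_restrictT f (@measurable_Rplus R)).
have f0' z : 0 <= (f \_ Rplus) z by rewrite patchE; case: ifPn => //; rewrite inE; exact: f0.
have mN : measurable (~` Rplus : set R) by apply: measurableC; exact: measurable_Rplus.
rewrite (ge0_negligible_integral mN)//; last 3 first.
- by apply/measurable_EFinP; apply: measurableT_comp => //; exact: measurable_funD.
- by move=> a _; rewrite lee_fin.
- exact: arrival_lt0 PhiP.
rewrite setTD setCK /EA /Rintegral fineK; last first.
  apply: integrable_fin_num; first exact: measurable_Rplus.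
  exact: wspace_shift_integrable.
apply: eq_integral => a; rewrite inE RplusE => a0.
by rewrite patchE ifT// inE RplusE addr_ge0.
Qed.

Lemma integral_next f t : wspace C f ->
  (\int[P]_w (f (Q t.+1 w))%:E = \int[P]_w (next_mean f (Q t w))%:E)%E.
Proof.
move=> wf; have [mf f0 _] := wf.
have mf' : measurable_fun setT (EFin \o (f \_ Rplus)).
  by apply/measurable_EFinP/(measurable_restrictT f (@measurable_Rplus R)).
have f0' z : (0 <= (EFin \o (f \_ Rplus)) z)%E.
  by rewrite lee_fin patchE; case: ifPn => //; rewrite inE; exact: f0.
have restrictE y : 0 <= y -> (f \_ Rplus) y = f y.
  by move=> y0; rewrite patchE ifT// inE RplusE.
transitivity (\int[P]_w (EFin \o (f \_ Rplus))
    (queue p th (fun s => A s) (fun s => U s) q t.+1 w))%E.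
  apply: eq_integral => w _; rewrite -queue_restrict; congr EFin.
  by apply/esym/restrictE; exact: queue_ge0.
rewrite (integral_queueS noiseP (measurable_win_prob M rhoP) measurable_th
  (win_prob_ge0 M rhoP) (win_prob_le1 M rhoP) q t mf' f0').
apply: eq_integral => w _; rewrite -queue_restrict.
have Q0 := queue_ge0 t w.
have -> : th (Q t w) = theta (Q t w) by rewrite /th patchE ifT// inE RplusE.
by rewrite /= !integral_shift ?pos_ge0// -!EFinM -EFinD.
Qed.

(** [W] is itself in [wspace C], so the one-step formula applies to it; win or loss, a slot
    multiplies the mean weight by at most [g]. *)
Lemma integral_W_queue t : (\int[P]_w (W (Q t w))%:E <= (g ^+ t * W q)%:E)%E.
Proof.
have domW : dominated 1 W by move=> y y0; rewrite mul1r ger0_norm ?W_ge0.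
have wW : wspace C W by apply: (dominated_wspace mW _ _ domW) => // y; exact: W_ge0.
elim: t => [|t IH].
  rewrite expr0 mul1r (eq_integral (cst (W q)%:E))//.
  by rewrite integral_probability_cst.
rewrite integral_next//.
apply: (@le_trans _ _ (\int[P]_w (g%:E * (W (Q t w))%:E))%E).
  apply: ge0_le_integral => //.
  - by move=> w _; rewrite lee_fin next_mean_ge0 ?queue_ge0.
  - apply/measurable_EFinP; apply: measurable_comp_queue; exact: measurable_next_mean.
  - by apply/measurable_EFinP; apply: measurable_funM => //; exact: measurable_comp_queue.
  - move=> w _; have Q0 := queue_ge0 t w; rewrite -EFinM lee_fin /next_mean.
    have p0 := win_prob_ge0 M rhoP (theta (Q t w)).
    have p1 : 0 <= 1 - p (theta (Q t w)) by rewrite subr_ge0 (win_prob_le1 M rhoP).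
    have h1 := le_trans (ler_norm _) (EA_shift_norm_le ler01 domW Q0 (lexx _) mW).
    have h2 := le_trans (ler_norm _)
      (EA_shift_norm_le ler01 domW (pos_ge0 _) (pos_subr1_le Q0) mW).
    move: (ler_wpM2l p1 h1) (ler_wpM2l p0 h2) => e1 e2; have := lerD e1 e2; lra.
rewrite ge0_integralZl_EFin//; last 2 first.
- by move=> w _; rewrite lee_fin W_ge0 ?queue_ge0.
- by apply/measurable_EFinP; exact: measurable_comp_queue.
by rewrite exprS -mulrA EFinM lee_wpmul2l// lee_fin.
Qed.

Definition stage_cost (y : R) : R := C y + r (theta y).

Lemma stage_cost_ge0 y : 0 <= y -> 0 <= stage_cost y.
Proof.
move=> y0; apply: addr_ge0; first by apply: C_ge0; rewrite RplusE.
by apply: (payment_ge0 M rhoP); case: theta_policy => _; apply; rewrite RplusE.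
Qed.

Lemma measurable_stage_cost : measurable_fun Rplus stage_cost.
Proof.
apply: measurable_funD => //.
by apply: measurableT_comp; [exact: measurable_payment rhoP|case: theta_policy].
Qed.

Local Notation cost t := (\int[P]_w (beta ^+ t * stage_cost (Q t w))%:E)%E.
Local Notation tail f t := (\int[P]_w (beta ^+ t * f (Q t w))%:E)%E.

Lemma policy_cost_series :
  policy_cost A U M beta C rho theta q = (\sum_(0 <= t <oo) cost t)%E.
Proof.
rewrite /policy_cost integral_nneseries//.
- move=> t; apply/measurable_EFinP; apply: measurable_funM => //.
  exact: measurable_comp_queue measurable_stage_cost.
- move=> t w _; rewrite lee_fin mulr_ge0 ?exprn_ge0 ?(ltW beta_gt0)//.
  by apply: stage_cost_ge0; exact: queue_ge0.
Qed.

Lemma cost_ge0 t : (0 <= cost t)%E.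
Proof.
apply: integral_ge0 => w _; rewrite lee_fin mulr_ge0 ?exprn_ge0 ?(ltW beta_gt0)//.
by apply: stage_cost_ge0; exact: queue_ge0.
Qed.

Lemma cost_tailS f t : wspace C f ->
  (cost t + tail f t.+1 =
   \int[P]_w (beta ^+ t * lookahead f (Q t w) (theta (Q t w)))%:E)%E.
Proof.
move=> wf; have [mf f0 _] := wf.
have bt s : 0 <= beta ^+ s by rewrite exprn_ge0// ltW.
have mn : measurable_fun setT (fun w => next_mean f (Q t w)).
  by apply: measurable_comp_queue; exact: measurable_next_mean.
have -> : (tail f t.+1 = \int[P]_w (beta ^+ t.+1 * next_mean f (Q t w))%:E)%E.
  under eq_integral do rewrite EFinM.
  rewrite ge0_integralZl_EFin ?integral_next//; last 2 first.
  - by move=> w _; rewrite lee_fin; apply: f0; rewrite RplusE queue_ge0.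
  - by apply/measurable_EFinP; exact: measurable_comp_queue.
  under [RHS]eq_integral do rewrite EFinM.
  rewrite ge0_integralZl_EFin//; last exact/measurable_EFinP.
  by move=> w _; rewrite lee_fin next_mean_ge0 ?queue_ge0.
rewrite -ge0_integralD//.
- apply: eq_integral => w _; rewrite -EFinD; congr EFin.
  by rewrite /lookahead /next_mean /stage_cost exprS; ring.
- by move=> w _; rewrite lee_fin mulr_ge0 ?stage_cost_ge0 ?queue_ge0.
- apply/measurable_EFinP; apply: measurable_funM => //.
  exact: measurable_comp_queue measurable_stage_cost.
- by move=> w _; rewrite lee_fin mulr_ge0 ?next_mean_ge0 ?queue_ge0.
- by apply/measurable_EFinP; exact: measurable_funM.
Qed.

Lemma tail0 f : tail f 0 = (f q)%:E.
Proof.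
rewrite (eq_integral (cst (f q)%:E)); last by move=> w _; rewrite expr0 mul1r.
exact: integral_probability_cst.
Qed.

(** The bid of [theta] is one competitor in the infimum defining T f = f; inserting it at time [n]
    extends the horizon by one slot. *)
Lemma fixed_point_le_partial_cost f n : wspace C f ->
  (forall y, 0 <= y -> T f y = f y) ->
  ((f q)%:E <= \sum_(0 <= t < n) cost t + tail f n)%E.
Proof.
move=> wf Tf; have [mf f0 _] := wf; elim: n => [|n IH].
  by rewrite big_geq// add0e tail0.
rewrite big_nat_recr//= -addeA cost_tailS//; apply: (le_trans IH).
rewrite leeD2l//; apply: ge0_le_integral => //.
- move=> w _; rewrite lee_fin mulr_ge0 ?exprn_ge0 ?(ltW beta_gt0)//.
  by apply: f0; rewrite RplusE queue_ge0.
- by apply/measurable_EFinP; apply: measurable_funM => //; exact: measurable_comp_queue.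
- apply/measurable_EFinP; apply: measurable_funM => //.
  apply: (@measurable_comp_queue (fun y => lookahead f y (theta y))).
  apply: measurable_funD; first exact: measurable_stage_cost.
  by apply: measurable_funM => //; exact: measurable_next_mean.
- move=> w _; have Q0 := queue_ge0 n w.
  rewrite lee_fin ler_wpM2l ?exprn_ge0 ?(ltW beta_gt0)// -Tf//.
  apply: bellman_le_lookahead => //.
  by case: theta_policy => _; apply; rewrite RplusE.
Qed.

Lemma fixed_point_eq_partial_cost f n : wspace C f ->
  (forall y, 0 <= y -> f y = lookahead f y (theta y)) ->
  (f q)%:E = (\sum_(0 <= t < n) cost t + tail f n)%E.
Proof.
move=> wf fE; elim: n => [|n IH]; first by rewrite big_geq// add0e tail0.
rewrite big_nat_recr//= -addeA cost_tailS// IH; congr (_ + _)%E.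
by apply: eq_integral => w _; rewrite fE ?queue_ge0.
Qed.

Lemma tail_ge0 f t : wspace C f -> (0 <= tail f t)%E.
Proof.
move=> [_ f0 _]; apply: integral_ge0 => w _.
by rewrite lee_fin mulr_ge0 ?exprn_ge0 ?(ltW beta_gt0)// f0// RplusE queue_ge0.
Qed.

Lemma tail_le f K t : wspace C f -> 0 <= K -> dominated K f ->
  (tail f t <= ((beta * g) ^+ t * (K * W q))%:E)%E.
Proof.
move=> wf K0 fK; have [mf f0 _] := wf.
have bK : 0 <= beta ^+ t * K by rewrite mulr_ge0 ?exprn_ge0// ltW.
apply: (@le_trans _ _ (\int[P]_w ((beta ^+ t * K)%:E * (W (Q t w))%:E))%E).
  apply: ge0_le_integral => //.
  - by move=> w _; rewrite lee_fin mulr_ge0 ?exprn_ge0 ?(ltW beta_gt0)// f0// RplusE queue_ge0.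
  - by apply/measurable_EFinP; apply: measurable_funM => //; exact: measurable_comp_queue.
  - by apply/measurable_EFinP; apply: measurable_funM => //; exact: measurable_comp_queue.
  - move=> w _; rewrite -EFinM lee_fin -mulrA ler_wpM2l ?exprn_ge0 ?(ltW beta_gt0)//.
    exact: le_trans (ler_norm _) (fK _ (queue_ge0 t w)).
rewrite ge0_integralZl_EFin//; last 2 first.
- by move=> w _; rewrite lee_fin W_ge0 ?queue_ge0.
- by apply/measurable_EFinP; exact: measurable_comp_queue.
apply: (le_trans (lee_wpmul2l _ (integral_W_queue t))); first by rewrite lee_fin.
by rewrite -EFinM lee_fin exprMn le_eqVlt; apply/orP; left; apply/eqP; ring.
Qed.

(** The cost may be infinite, so the bound is proved up to [e]: at a horizon N with tail below [e],
    the partial sum is at most the whole series. *)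
Lemma fixed_point_le_cost f : wspace C f -> (forall y, 0 <= y -> T f y = f y) ->
  ((f q)%:E <= policy_cost A U M beta C rho theta q)%E.
Proof.
move=> wf Tf; have [K K0 fK] := wspace_dominated wf.
apply/lee_addgt0Pr => e e0.
have lim0 : (beta * g) ^+ n * (K * W q) @[n --> \oo] --> 0.
  rewrite -[X in _ --> X](mul0r (K * W q)); apply: cvgMr_tmp.
  exact: (cvg_expr rate_norm_lt1).
move/cvgrPdist_lt : lim0 => /(_ _ e0)[N _ /(_ N (leqnn _))].
rewrite /= sub0r normrN => /ltW/(le_trans (ler_norm _)) Ne.
apply: (le_trans (fixed_point_le_partial_cost N wf Tf)).
rewrite policy_cost_series; apply: leeD.
  by apply: nneseries_lim_ge => t _ _; exact: cost_ge0.
by apply: (le_trans (tail_le N wf K0 fK)); rewrite lee_fin.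
Qed.

(** Dropping the nonnegative tail bounds every partial sum, hence the series, by [f q]. *)
Lemma cost_le_fixed_point f : wspace C f ->
  (forall y, 0 <= y -> f y = lookahead f y (theta y)) ->
  (policy_cost A U M beta C rho theta q <= (f q)%:E)%E.
Proof.
move=> wf fE; rewrite policy_cost_series; apply: lime_le.
  by apply: is_cvg_nneseries => t _ _; exact: cost_ge0.
apply: nearW => n; rewrite (fixed_point_eq_partial_cost n wf fE).
by rewrite leeDl// tail_ge0.
Qed.

End control.

Lemma argmin_cost (d : measure_display) (Omega : measurableType d)
    (P : probability Omega R) (A U : nat -> {RV P >-> R}) f q :
  driving_noise Phi A U -> wspace C f -> (forall y, 0 <= y -> T f y = f y) ->
  0 <= q ->
  policy_cost A U M beta C rho (fun y => beta * pos (Delta Phi f y)) q = (f q)%:E.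
Proof.
move=> noiseP wf Tf q0; have pol := argmin_policy wf.
apply/le_anti/andP; split; last exact: fixed_point_le_cost.
apply: cost_le_fixed_point => // y y0.
by rewrite -bellman_argmin// Tf.
Qed.

Lemma value_fixed_point (d : measure_display) (Omega : measurableType d)
    (P : probability Omega R) (A U : nat -> {RV P >-> R}) f q :
  driving_noise Phi A U -> wspace C f -> (forall y, 0 <= y -> T f y = f y) ->
  0 <= q -> value A U M beta C rho q = (f q)%:E.
Proof.
move=> noiseP wf Tf q0; apply/le_anti/andP; split.
  apply: ereal_inf_lbound; exists (fun y => beta * pos (Delta Phi f y)).
    exact: argmin_policy.
  exact: argmin_cost.
apply: le_ereal_inf_tmp => _ [theta pol <-]; exact: fixed_point_le_cost.
Qed.

End bellman.

(** * Choice of the growth rate; the fixed point as value *)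

Theorem lemma2 (R : realType) (M : nat) (hM : (2 <= M)%N)
  (beta : R) (hbeta0 : 0 < beta) (hbeta1 : beta < 1)
  (Abar : R) (Phi : probability R R) (hPhi : arrival_law Abar Phi)
  (C : R -> R)
  (C_ge0 : forall q, Rplus q -> 0 <= C q)
  (C_cont : {within Rplus, continuous C})
  (C_incr : forall x y, Rplus x -> Rplus y -> x <= y -> C x <= C y)
  (C_conv : strictly_convex_on Rplus C)
  (C_poly : exists m : nat, bigO_infty C (fun q => q ^+ m))
  (* C_poly alone does not bound C (q + a) / C q, and then bellman need not map
     wspace C into itself; C_doubling holds as soon as C has exact order q ^+ m *)
  (C_doubling : bigO_infty (fun q => C (2 * q)) C)
  (E : R) (rho : R -> R) (hrho : bid_distribution E rho) :
  let T := bellman M beta Phi C rho in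
  (forall f, wspace C f -> wspace C (T f)) /\
  (exists j : nat, wcontraction C (iter j T)) /\
  exists fstar : R -> R,
    [/\ wspace C fstar,
        forall q, Rplus q -> T fstar q = fstar q,
        forall g, wspace C g -> (forall q, Rplus q -> T g q = g q) ->
          forall q, Rplus q -> g q = fstar q &
        forall f, wspace C f ->
          wnorm C (iter n T f \- fstar) @[n --> \oo] --> 0%E] /\
    forall (d : measure_display) (Omega : measurableType d)
      (P : probability Omega R) (A U : nat -> {RV P >-> R}),
      driving_noise Phi A U ->
      let V := value A U M beta C rho in
      let Vhat := fun q => fine (V q) in
      [/\ forall q, Rplus q -> V q = (fstar q)%:E,
          wspace C Vhat,
          forall q, Rplus q -> Vhat q = T Vhat q &
          forall g, wspace C g -> (forall q, Rplus q -> g q = T g q) ->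
            forall q, Rplus q -> g q = Vhat q] /\
      optimal_policy A U M beta C rho (fun q => beta * pos (Delta Phi Vhat q)).
Proof.
have Abar0 := arrival_bound_ge0 hPhi.
(* Chosen so that beta * gam = (1 + beta) / 2 is the midpoint of beta and 1: this gives both 1 < gam
   and beta * gam < 1. *)
pose gam := (1 + beta) / (2 * beta).
have gam1 : 1 < gam by rewrite /gam ltr_pdivlMr ?mulr_gt0//; lra.
have gam0 : 0 <= gam by exact: le_trans ler01 (ltW gam1).
have rate : beta * gam < 1.
  have -> : beta * gam = (1 + beta) / 2 by rewrite /gam; field; rewrite gt_eqF.
  by rewrite ltr_pdivrMr//; lra.
have mC := measurable_cost C_cont.
have [W [D [mW D1 WE Wmon Wgrow]]] :=
  weight_equiv C_ge0 C_cont C_incr C_conv C_doubling Abar0 gam1.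
have step f : wspace C f -> wspace C (bellman M beta Phi C rho f).
  exact: (bellman_wspace hM hbeta0 hPhi hrho C_ge0 mC gam0 WE Wmon Wgrow).
move=> T; split; first exact: step.
split.
  exact: (iter_bellman_contraction hM hbeta0 hPhi hrho C_ge0 mC D1 gam0 rate WE Wmon Wgrow).
have [fstar wfs Tfs] :=
  fixed_point_exists hM hbeta0 hPhi hrho C_ge0 mC gam0 rate WE Wmon Wgrow.
have uniq f h : wspace C f -> wspace C h -> (forall q, 0 <= q -> T f q = f q) ->
    (forall q, 0 <= q -> T h q = h q) -> forall q, 0 <= q -> f q = h q.
  exact: (fixed_point_unique hM hbeta0 hPhi hrho gam0 rate WE Wmon Wgrow).
exists fstar; split.
  split => //.
  - by move=> q; rewrite RplusE; exact: Tfs.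
  - move=> h wh Th q; rewrite RplusE => q0; apply: uniq => // y y0.
    by apply: Th; rewrite RplusE.
  - move=> f wf.
    exact: (iter_bellman_cvg hM hbeta0 hPhi hrho C_ge0 mC gam0 rate WE Wmon Wgrow).
move=> d Omega P A U noiseP V Vhat.
have VE q : 0 <= q -> V q = (fstar q)%:E.
  exact: (value_fixed_point hM hbeta0 hPhi hrho C_ge0 mC gam0 rate mW WE Wmon Wgrow).
have fVhat q : 0 <= q -> fstar q = Vhat q by move=> q0; rewrite /Vhat VE.
have wV : wspace C Vhat by exact: eq_wspace fVhat wfs.
have TV q : 0 <= q -> T Vhat q = Vhat q.
  move=> q0; rewrite -fVhat// -[in RHS]Tfs//; apply/esym.
  exact: (eq_bellman hM hbeta0 hPhi hrho WE Wmon Wgrow).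
split; first split => //.
- by move=> q; rewrite RplusE; exact: VE.
- by move=> q; rewrite RplusE => /TV.
- move=> h wh Th q; rewrite RplusE => q0; apply: uniq => // y y0.
  by rewrite -Th// RplusE.
split.
  exact: (argmin_policy hbeta0 hPhi WE Wmon Wgrow).
move=> q; rewrite RplusE => q0; rewrite -[RHS]/(V q) VE// fVhat//.
(* The policy is built from [Vhat], so the cost identity is applied to [Vhat] itself, a fixed point
   by [wV] and [TV]. *)
exact: (argmin_cost hM hbeta0 hPhi hrho C_ge0 mC gam0 rate mW WE Wmon Wgrow).
Qed.
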